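(* Every simply connected quasi-strict $3$-groupoid is weakly equivalent, via a pseudo-functor, to a strict $3$-groupoid: for every simply connected quasi-strict $3$-groupoid $G$ there exist a strict $3$-groupoid $H$ and a pseudo-functor $H\to G$ which is a weak equivalence.
   Context: Strict $\infty$-categories and $\infty$-groupoids. A strict $\infty$-category $X$ consists of sets $X_i$ ($i\ge 0$) of $i$-arrows (objects are $0$-arrows), maps $s_i,t_i:X_i\to X_{i-1}$ ($i\ge1$; source and target) with $s_is_{i+1}=s_it_{i+1}$ and $t_is_{i+1}=t_it_{i+1}$, maps $k_i:X_i\to X_{i+1}$ (units), and, for $i>j\ge0$, compositions $*^i_j$ defined on pairs $(v,u)\in X_i\times X_i$ with $s^i_j(v)=t^i_j(u)$ and with values in $X_i$; here $s^i_j=s_{j+1}\cdots s_i$, $t^i_j=t_{j+1}\cdots t_i$, $k^i_j=k_{i-1}\cdots k_j:X_j\to X_i$. Axioms: $s_i(v*^i_ju)$ is $s_i(u)$ if $j=i-1$ and $s_i(v)*^{i-1}_js_i(u)$ if $j<i-1$; $t_i(v*^i_ju)$ is $t_i(v)$ if $j=i-1$ and $t_i(v)*^{i-1}_jt_i(u)$ if $j<i-1$; $s_{i+1}k_i(u)=u=t_{i+1}k_i(u)$; each $*^i_j$ is associative; exchange law $(\delta *^i_j\gamma)*^i_k(\beta*^i_j\alpha)=(\delta*^i_k\beta)*^i_j(\gamma*^i_k\alpha)$ for $i>j>k\ge0$ when $s^i_j\delta=t^i_j\gamma$, $s^i_k\gamma=t^i_k\beta$, $s^i_j\beta=t^i_j\alpha$;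 units $u*^i_jk^i_js^i_j(u)=u=k^i_jt^i_j(u)*^i_ju$; and $k_i(v*^i_ju)=k_i(v)*^{i+1}_jk_i(u)$. $X$ is a strict $\infty$-groupoid if for all $i>j\ge0$ every $i$-arrow $u$ has a $*^i_j$-inverse, i.e. an $i$-arrow $v$ with $s^i_j(v)=t^i_j(u)$, $t^i_j(v)=s^i_j(u)$, $u*^i_jv=k^i_jt^i_j(u)$, $v*^i_ju=k^i_js^i_j(u)$. Quasi-strict groupoids. In a strict $\infty$-category, define by mutual coinduction: two $n$-arrows $x,y$ are weakly homotopic if there is a weakly invertible $(n+1)$-arrow $u:x\to y$; an $(n+1)$-arrow $u:x\to y$ is weakly invertible if there is an $(n+1)$-arrow $v:y\to x$ such that $u*^{n+1}_nv$ and $v*^{n+1}_nu$ are weakly homotopic to identities. A quasi-strict $\infty$-groupoid is a strict $\infty$-category all of whose $n$-arrows, $n\ge1$, are weakly invertible. A (quasi-strict, resp. strict) $3$-groupoid is a (quasi-strict, resp. strict) $\infty$-groupoid all of whose $n$-arrows with $n>3$ are units, i.e. a strict $3$-category with the corresponding invertibility. Homotopy groups. In a quasi-strict $\infty$-groupoid $G$, two $n$-arrows $u,v$ are homotopic if there is an $(n+1)$-arrow $u\to v$; this is an equivalence relation. $\pi_0(G)$ is the set of objects modulo homotopy; for $n\ge1$ and $x$ an object, $\pi_n(G,x)$ is the group, under $*^n_{n-1}$, of $n$-arrows $k^{n-1}_0(x)\to k^{n-1}_0(x)$ modulo homotopy. $G$ is simply connected if $\pi_0(G)$ is a singleton and $\pi_1(G,x)$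 is trivial for every object $x$. A pseudo-functor between $3$-categories is a weak functor (trihomomorphism in the sense of Gordon–Power–Street), preserving compositions and units up to coherent equivalence. It is a weak equivalence if it induces a bijection on $\pi_0$ and isomorphisms on $\pi_n$ for all $n\ge1$ and all base objects of its source. *)

(* Defs.v *)
Set Implicit Arguments.
Unset Strict Implicit.
Unset Printing Implicit Defensive.

(** * Strict infinity-categories *)

(* [comp i j v u] stands for the composite [v *^i_j u] of two [i]-arrows.  It is
   a total function, but it is only constrained by the axioms below when [j < i]
   and [s^i_j v = t^i_j u]; its other values are irrelevant. *)
Record inf_cat_data : Type := InfCatData {
  arr :> nat -> Type;
  src : forall i, arr (S i) -> arr i;
  tgt : forall i, arr (S i) -> arr i;
  idc : forall i, arr i -> arr (S i);
  comp : forall i, nat -> arr i -> arr i -> arr i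
}.

Arguments src {_ i} _.
Arguments tgt {_ i} _.
Arguments idc {_ i} _.
Arguments comp {_ i} _ _ _.

(* [s^(d+j)_j], [t^(d+j)_j] and [k^(d+j)_j]. *)
Fixpoint srcn (C : inf_cat_data) (d j : nat) : C (d + j) -> C j :=
  match d with
  | 0 => fun u => u
  | S d' => fun u => srcn (d := d') (src u)
  end.

Fixpoint tgtn (C : inf_cat_data) (d j : nat) : C (d + j) -> C j :=
  match d with
  | 0 => fun u => u
  | S d' => fun u => tgtn (d := d') (tgt u)
  end.

Fixpoint idcn (C : inf_cat_data) (d j : nat) : C j -> C (d + j) :=
  match d with
  | 0 => fun u => u
  | S d' => fun u => idc (idcn d' u)
  end.

Arguments srcn {_} d j _.
Arguments tgtn {_} d j _.
Arguments idcn {_} d j _.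

Definition composable (C : inf_cat_data) (d j : nat) (v u : C (d + j)) : Prop :=
  srcn d j v = tgtn d j u.

Arguments composable {_} d j _ _.

(* A pair [i > j] is written [i = S d + j]. *)
Record inf_cat_axioms (C : inf_cat_data) : Prop := InfCatAxioms {
  src_src : forall i (u : C (S (S i))), src (src u) = src (tgt u);
  tgt_tgt : forall i (u : C (S (S i))), tgt (src u) = tgt (tgt u);
  src_comp_top : forall j (v u : C (S j)),
    src v = tgt u -> src (comp j v u) = src u;
  tgt_comp_top : forall j (v u : C (S j)),
    src v = tgt u -> tgt (comp j v u) = tgt v;
  src_comp : forall d j (v u : C (S (S d) + j)),
    composable (S (S d)) j v u -> src (comp j v u) = comp j (src v) (src u);
  tgt_comp : forall d j (v u : C (S (S d) + j)),
    composable (S (S d)) j v u -> tgt (comp j v u) = comp j (tgt v) (tgt u);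
  src_idc : forall i (u : C i), src (idc u) = u;
  tgt_idc : forall i (u : C i), tgt (idc u) = u;
  comp_assoc : forall d j (w v u : C (S d + j)),
    composable (S d) j w v -> composable (S d) j v u ->
    comp j (comp j w v) u = comp j w (comp j v u);
  (* here [i = S d + j] and [j = S e + k], and [s^i_k] is the composite of
     [s^i_j] and [s^j_k] *)
  exchange : forall d e k,
    let j := S e + k in
    forall delta gamma beta alpha : C (S d + j),
    composable (S d) j delta gamma ->
    srcn (S e) k (srcn (S d) j gamma) = tgtn (S e) k (tgtn (S d) j beta) ->
    composable (S d) j beta alpha ->
    comp k (comp j delta gamma) (comp j beta alpha) =
    comp j (comp k delta beta) (comp k gamma alpha);
  comp_idcr : forall d j (u : C (S d + j)),
    comp j u (idcn (S d) j (srcn (S d) j u)) = u;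
  comp_idcl : forall d j (u : C (S d + j)),
    comp j (idcn (S d) j (tgtn (S d) j u)) u = u;
  idc_comp : forall d j (v u : C (S d + j)),
    composable (S d) j v u -> idc (comp j v u) = comp j (idc v) (idc u)
}.

Record inf_cat : Type := InfCat {
  inf_cat_sort :> inf_cat_data;
  inf_catP : inf_cat_axioms inf_cat_sort
}.

Definition hom (C : inf_cat_data) (n : nat) (x y : C n) (u : C (S n)) : Prop :=
  src u = x /\ tgt u = y.

(** * Invertibility and groupoids *)

Definition has_inverse (C : inf_cat_data) (d j : nat) (u : C (S d + j)) : Prop :=
  exists v : C (S d + j),
    srcn (S d) j v = tgtn (S d) j u /\
    tgtn (S d) j v = srcn (S d) j u /\
    comp j u v = idcn (S d) j (tgtn (S d) j u) /\
    comp j v u = idcn (S d) j (srcn (S d) j u).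

Arguments has_inverse {_} d j _.

Definition strict_groupoid (C : inf_cat_data) : Prop :=
  forall d j (u : C (S d + j)), has_inverse d j u.

CoInductive weakly_homotopic (C : inf_cat_data) :
    forall n, C n -> C n -> Prop :=
  | WeaklyHomotopic n (x y : C n) (u : C (S n)) :
      hom x y u -> weakly_invertible u -> weakly_homotopic x y
with weakly_invertible (C : inf_cat_data) : forall n, C (S n) -> Prop :=
  | WeaklyInvertible n (x y : C n) (u v : C (S n)) :
      hom x y u -> hom y x v ->
      weakly_homotopic (comp n u v) (idc y) ->
      weakly_homotopic (comp n v u) (idc x) ->
      weakly_invertible u.

Definition quasi_strict_groupoid (C : inf_cat_data) : Prop :=
  forall n (u : C (S n)), weakly_invertible u.

Definition units_above_3 (C : inf_cat_data) : Prop :=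
  forall n (u : C (S n)), 3 < S n -> exists v : C n, u = idc v.

Definition strict_3groupoid (C : inf_cat_data) : Prop :=
  strict_groupoid C /\ units_above_3 C.

Definition quasi_strict_3groupoid (C : inf_cat_data) : Prop :=
  quasi_strict_groupoid C /\ units_above_3 C.

(** * Homotopy groups *)

Definition homotopic (C : inf_cat_data) (n : nat) (x y : C n) : Prop :=
  exists u : C (S n), hom x y u.

(* [k^n_0 x] *)
Fixpoint idobj (C : inf_cat_data) (n : nat) (x : C 0) : C n :=
  match n with
  | 0 => x
  | S n' => idc (idobj n' x)
  end.

(* The [n.+1]-arrows whose classes modulo [homotopic] are the elements of
   [pi_(n+1)(C, x)]; the group law is induced by [comp n].  The quotients
   [pi_0] and [pi_(n+1)] are handled as setoids throughout. *)
Definition loop (C : inf_cat_data) (n : nat) (x : C 0) (u : C (S n)) : Prop :=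
  hom (idobj n x) (idobj n x) u.

Definition simply_connected (C : inf_cat_data) : Prop :=
  (exists x : C 0, forall y : C 0, homotopic y x) /\
  (forall (x : C 0) (u : C 1), loop x u -> homotopic u (idc x)).

(** * Pseudo-functors of 3-categories *)

Local Notation "v *0 u" := (comp 0 v u) (at level 40, left associativity).
Local Notation "v *1 u" := (comp 1 v u) (at level 40, left associativity).
Local Notation "v *2 u" := (comp 2 v u) (at level 40, left associativity).
Local Notation "# u" := (idc u) (at level 9, u at level 9, format "# u").

(* Trihomomorphisms of Gordon-Power-Street, between 3-categories which are
   strict, so that the associators, unitors and structural modifications of
   source and target are identities.  The components at these identities of
   the functors on hom-bicategories have been absorbed into [tri_omega],
   [tri_gamma] and [tri_delta] by means of [tri_phi0].
   - [tri_phi], [tri_phi0] : the constraints of the homomorphisms of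
     bicategories [C(a, b) -> D(F a, F b)];
   - [tri_chi], [tri_chi2] : the 1-cells and the naturality 2-cells of the
     pseudo-natural equivalence comparing compositions along objects;
   - [tri_iota], [tri_iota2] : the same for units of objects;
   - [tri_omega], [tri_gamma], [tri_delta] : the modifications for
     associativity, the left unit and the right unit.
   Arguments come in the order of composition, and the values at arguments
   which are not composable are irrelevant. *)
Record trihom_data (C D : inf_cat_data) : Type := TrihomData {
  tri0 : C 0 -> D 0;
  tri1 : C 1 -> D 1;
  tri2 : C 2 -> D 2;
  tri3 : C 3 -> D 3;
  tri_phi : C 2 -> C 2 -> D 3;
  tri_phi0 : C 1 -> D 3;
  tri_chi : C 1 -> C 1 -> D 2;
  tri_chi2 : C 2 -> C 2 -> D 3;
  tri_iota : C 0 -> D 2;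
  tri_iota2 : C 0 -> D 3;
  tri_omega : C 1 -> C 1 -> C 1 -> D 3;
  tri_gamma : C 1 -> D 3;
  tri_delta : C 1 -> D 3
}.

(* Invertible 3-arrow [x -> y]. *)
Definition iso3 (D : inf_cat_data) (x y : D 2) (u : D 3) : Prop :=
  hom x y u /\ has_inverse 0 2 u.

Section TrihomAxioms.

Variables (C D : inf_cat_data) (F : trihom_data C D).

Local Notation F0 := (tri0 F).
Local Notation F1 := (tri1 F).
Local Notation F2 := (tri2 F).
Local Notation F3 := (tri3 F).
Local Notation phi := (tri_phi F).
Local Notation phi0 := (tri_phi0 F).
Local Notation chi := (tri_chi F).
Local Notation chi2 := (tri_chi2 F).
Local Notation iota := (tri_iota F).
Local Notation iota2 := (tri_iota2 F).
Local Notation omega := (tri_omega F).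
Local Notation gamma := (tri_gamma F).
Local Notation delta := (tri_delta F).

Record globular_axioms : Prop := GlobularAxioms {
  tri1_hom : forall x y (f : C 1), hom x y f -> hom (F0 x) (F0 y) (F1 f);
  tri2_hom : forall f g (a : C 2), hom f g a -> hom (F1 f) (F1 g) (F2 a);
  tri3_hom : forall a b (T : C 3), hom a b T -> hom (F2 a) (F2 b) (F3 T)
}.

(* The maps [C(x, y) -> D(F x, F y)] are homomorphisms of bicategories. *)
Record local_axioms : Prop := LocalAxioms {
  tri3_comp : forall T' T : C 3, src T' = tgt T ->
    F3 (T' *2 T) = F3 T' *2 F3 T;
  tri3_idc : forall a : C 2, F3 #a = #(F2 a);
  phi_iso : forall b a : C 2, src b = tgt a ->
    iso3 (F2 b *1 F2 a) (F2 (b *1 a)) (phi b a);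
  phi0_iso : forall f : C 1, iso3 #(F1 f) (F2 #f) (phi0 f);
  phi_nat : forall (b b' a a' : C 2) (T S : C 3),
    hom b b' T -> hom a a' S -> src b = tgt a ->
    phi b' a' *2 (F3 T *1 F3 S) = F3 (T *1 S) *2 phi b a;
  phi_assoc : forall c b a : C 2, src c = tgt b -> src b = tgt a ->
    phi c (b *1 a) *2 (#(F2 c) *1 phi b a) =
    phi (c *1 b) a *2 (phi c b *1 #(F2 a));
  phi_idr : forall f g (a : C 2), hom f g a ->
    phi a #f *2 (#(F2 a) *1 phi0 f) = #(F2 a);
  phi_idl : forall f g (a : C 2), hom f g a ->
    phi #g a *2 (phi0 g *1 #(F2 a)) = #(F2 a)
}.

(* [chi] is a pseudo-natural equivalence, from [(g, f) |-> F g *0 F f] to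
   [(g, f) |-> F (g *0 f)]. *)
Record chi_axioms : Prop := ChiAxioms {
  chi_hom : forall g f : C 1, src g = tgt f ->
    hom (F1 g *0 F1 f) (F1 (g *0 f)) (chi g f);
  chi_equiv : forall g f : C 1, src g = tgt f -> weakly_invertible (chi g f);
  chi2_iso : forall (g g' f f' : C 1) (b a : C 2),
    hom g g' b -> hom f f' a -> src g = tgt f ->
    iso3 (F2 (b *0 a) *1 chi g f) (chi g' f' *1 (F2 b *0 F2 a)) (chi2 b a);
  chi2_nat : forall (g g' f f' : C 1) (b b' a a' : C 2) (T S : C 3),
    hom b b' T -> hom a a' S -> hom g g' b -> hom f f' a -> src g = tgt f ->
    chi2 b' a' *2 (F3 (T *0 S) *1 #(chi g f)) =
    (#(chi g' f') *1 (F3 T *0 F3 S)) *2 chi2 b a;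
  chi2_idc : forall g f : C 1, src g = tgt f ->
    chi2 #g #f *2 (phi0 (g *0 f) *1 #(chi g f)) =
    #(chi g f) *1 (phi0 g *0 phi0 f);
  chi2_comp : forall (g g' g'' f f' f'' : C 1) (b b' a a' : C 2),
    hom g g' b -> hom g' g'' b' -> hom f f' a -> hom f' f'' a' ->
    src g = tgt f ->
    chi2 (b' *1 b) (a' *1 a) *2 (phi (b' *0 a') (b *0 a) *1 #(chi g f)) =
    (#(chi g'' f'') *1 (phi b' b *0 phi a' a)) *2
      ((chi2 b' a' *1 #(F2 b *0 F2 a)) *2
       (#(F2 (b' *0 a')) *1 chi2 b a))
}.

(* For each object [x], [iota x] is a pseudo-natural equivalence between
   homomorphisms from the unit bicategory, choosing [#(F x)] and [F #x]. *)
Record iota_axioms : Prop := IotaAxioms {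
  iota_hom : forall x : C 0, hom #(F0 x) (F1 #x) (iota x);
  iota_equiv : forall x : C 0, weakly_invertible (iota x);
  iota2_iso : forall x : C 0,
    iso3 (F2 ##x *1 iota x) (iota x *1 ##(F0 x)) (iota2 x);
  iota2_idc : forall x : C 0,
    iota2 x *2 (phi0 #x *1 #(iota x)) = #(iota x);
  iota2_comp : forall x : C 0,
    iota2 x *2 (phi ##x ##x *1 #(iota x)) =
    iota2 x *2 (#(F2 ##x) *1 iota2 x)
}.

Record modification_axioms : Prop := ModificationAxioms {
  omega_iso : forall h g f : C 1, src h = tgt g -> src g = tgt f ->
    iso3 (chi (h *0 g) f *1 (chi h g *0 #(F1 f)))
         (chi h (g *0 f) *1 (#(F1 h) *0 chi g f))
         (omega h g f);
  omega_nat : forall (h h' g g' f f' : C 1) (c b a : C 2),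
    hom h h' c -> hom g g' b -> hom f f' a -> src h = tgt g -> src g = tgt f ->
    (omega h' g' f' *1 #(F2 c *0 F2 b *0 F2 a)) *2
      ((#(chi (h' *0 g') f') *1 (chi2 c b *0 #(F2 a))) *2
       (chi2 (c *0 b) a *1 #(chi h g *0 #(F1 f)))) =
    (#(chi h' (g' *0 f')) *1 (#(F2 c) *0 chi2 b a)) *2
      ((chi2 c (b *0 a) *1 #(#(F1 h) *0 chi g f)) *2
       (#(F2 (c *0 b *0 a)) *1 omega h g f));
  gamma_iso : forall x y (f : C 1), hom x y f ->
    iso3 (chi #y f *1 (iota y *0 #(F1 f))) #(F1 f) (gamma f);
  gamma_nat : forall x y (f f' : C 1) (a : C 2),
    hom x y f -> hom f f' a ->
    (gamma f' *1 #(F2 a)) *2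
      ((#(chi #y f') *1 (iota2 y *0 #(F2 a))) *2
       (chi2 ##y a *1 #(iota y *0 #(F1 f)))) =
    #(F2 a) *1 gamma f;
  delta_iso : forall x y (f : C 1), hom x y f ->
    iso3 (chi f #x *1 (#(F1 f) *0 iota x)) #(F1 f) (delta f);
  delta_nat : forall x y (f f' : C 1) (a : C 2),
    hom x y f -> hom f f' a ->
    (delta f' *1 #(F2 a)) *2
      ((#(chi f' #x) *1 (#(F2 a) *0 iota2 x)) *2
       (chi2 a ##x *1 #(#(F1 f) *0 iota x))) =
    #(F2 a) *1 delta f
}.

Record coherence_axioms : Prop := CoherenceAxioms {
  omega_assoc : forall k h g f : C 1,
    src k = tgt h -> src h = tgt g -> src g = tgt f ->
    (#(chi k (h *0 g *0 f)) *1 (##(F1 k) *0 omega h g f)) *2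
      ((omega k (h *0 g) f *1 #(#(F1 k) *0 chi h g *0 #(F1 f))) *2
       (#(chi (k *0 h *0 g) f) *1 (omega k h g *0 ##(F1 f)))) =
    (omega k h (g *0 f) *1 #(#(F1 k) *0 #(F1 h) *0 chi g f)) *2
      (omega (k *0 h) g f *1 #(chi k h *0 #(F1 g) *0 #(F1 f)));
  omega_unit : forall x y z (g f : C 1), hom y z g -> hom x y f ->
    (#(chi g f) *1 (##(F1 g) *0 gamma f)) *2
      (omega g #y f *1 #(#(F1 g) *0 iota y *0 #(F1 f))) =
    #(chi g f) *1 (delta g *0 ##(F1 f))
}.

End TrihomAxioms.

Record pseudo_functor (C D : inf_cat) : Type := PseudoFunctor {
  pf_data :> trihom_data C D;
  pf_globular : globular_axioms pf_data;
  pf_local : local_axioms pf_data;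
  pf_chi : chi_axioms pf_data;
  pf_iota : iota_axioms pf_data;
  pf_modification : modification_axioms pf_data;
  pf_coherence : coherence_axioms pf_data
}.

(** * Weak equivalences *)

Section WeakEquivalence.

Variables (C D : inf_cat) (F : pseudo_functor C D).

(* [pi_map x n u v]: the class of the loop [v] in [pi_(n+1)(D, F x)] is the
   image under [F] of the class of the loop [u] in [pi_(n+1)(C, x)].  As [F]
   preserves the units of [x] only up to [iota x] and [phi0 #x], the image of
   [u] has to be conjugated by these.  In dimension [> 3], where 3-categories
   have only units, the unit is sent to the unit. *)
Definition pi_map (x : C 0) (n : nat) : C (S n) -> D (S n) -> Prop :=
  match n with
  | 0 => fun u v => homotopic (tri1 F u) v
  | 1 => fun u v => homotopic (tri_iota F x *1 v) (tri2 F u *1 tri_iota F x)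
  | 2 => fun u v =>
      homotopic ((tri_phi0 F #x *1 #(tri_iota F x)) *2 (#(tri_iota F x) *1 v))
                ((tri3 F u *1 #(tri_iota F x)) *2
                 (tri_phi0 F #x *1 #(tri_iota F x)))
  | S (S (S _)) => fun u v =>
      homotopic u (idobj _ x) /\ homotopic v (idobj _ (tri0 F x))
  end.

Definition pi0_bijective : Prop :=
  (forall x y : C 0, homotopic x y <-> homotopic (tri0 F x) (tri0 F y)) /\
  (forall y : D 0, exists x : C 0, homotopic (tri0 F x) y).

(* [pi_map x n] is the graph of a group isomorphism. *)
Record pi_isomorphic (x : C 0) (n : nat) : Prop := PiIsomorphic {
  pi_map_total : forall u : C (S n), loop x u ->
    exists v : D (S n), loop (tri0 F x) v /\ pi_map x u v;
  pi_map_surj : forall v : D (S n), loop (tri0 F x) v ->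
    exists u : C (S n), loop x u /\ pi_map x u v;
  pi_map_inj : forall (u u' : C (S n)) (v v' : D (S n)),
    loop x u -> loop x u' -> loop (tri0 F x) v -> loop (tri0 F x) v' ->
    pi_map x u v -> pi_map x u' v' -> (homotopic u u' <-> homotopic v v');
  pi_map_comp : forall (u u' : C (S n)) (v v' : D (S n)),
    loop x u -> loop x u' -> loop (tri0 F x) v -> loop (tri0 F x) v' ->
    pi_map x u v -> pi_map x u' v' -> pi_map x (comp n u u') (comp n v v')
}.

Definition weak_equivalence : Prop :=
  pi0_bijective /\ forall (x : C 0) (n : nat), pi_isomorphic x n.

End WeakEquivalence.

(* Main.v *)
(** Fix an object [x0]. By Eckmann-Hilton, the 2-arrows and 3-arrows of [G]
    over the unit arrow of [x0] form a Picard groupoid [P] which is strictly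
    commutative (its symmetry is the identity), and since [G] is simply
    connected this groupoid carries its whole homotopy type. Let [A] be the
    free abelian group on the objects of [P]. Choosing for each object [x] a
    weak inverse [dual x] and an arrow [ev x : x + dual x -> 0], one
    realizes [a = sum x_i - sum y_j] as [real a = sum x_i + sum (dual y_j)].
    Cancelling pairs with [ev] gives arrows [mu a b : real a + real b ->
    real (a + b)], which are coherent because, by strict commutativity, a
    composite of cancellations depends only on the multiset of cancelled
    pairs. The pairs of [c : A] and [0 -> real c] form an abelian group [B]
    over [A], and the complex [B -> A], placed in dimensions 3 and 2, is a
    strict 3-groupoid; [real] and [mu] make up the required pseudo-functor
    from it to [G]. *)

From HB Require Import structures.
From mathcomp Require Import all_boot ssralg zify.
From mathcomp Require Import finmap multiset boolp.
Require Import Defs.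

Set Implicit Arguments.
Unset Strict Implicit.
Unset Printing Implicit Defensive.

Import GRing.Theory.
Local Open Scope ring_scope.

(** * The strict 3-groupoid of a two-term complex *)

Section Complex.

Variables (A B : zmodType) (bd : {additive B -> A}).

(* The pair [(a, b)] is the 3-arrow [a -> a + bd b], or one of its units; both
   [*0] and [*1] are the addition. *)
Definition cx_arr (n : nat) : Type :=
  match n with 0 | 1 => unit | 2 => A | _ => (A * B)%type end.

Definition cx_ob (n : nat) : cx_arr n -> A :=
  match n with
  | 0 | 1 => fun=> 0 | 2 => fun a => a | _ => fun p => p.1
  end.

Definition cx_inc (n : nat) : cx_arr n -> B :=
  match n with 0 | 1 | 2 => fun=> 0 | _ => fun p => p.2 end.

Definition cx_mk (n : nat) (a : A) (b : B) : cx_arr n :=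
  match n with 0 | 1 => tt | 2 => a | _ => (a, b) end.

Definition cx_src (n : nat) (u : cx_arr n.+1) : cx_arr n :=
  cx_mk n (cx_ob u) (cx_inc u).

Definition cx_tgt (n : nat) (u : cx_arr n.+1) : cx_arr n :=
  cx_mk n (if n == 2%N then cx_ob u + bd (cx_inc u) else cx_ob u) (cx_inc u).

Definition cx_idc (n : nat) (u : cx_arr n) : cx_arr n.+1 :=
  cx_mk n.+1 (cx_ob u) (cx_inc u).

(** For [j > 2] only equal arrows are composable, so either of them is the composite. *)
Definition cx_comp (n j : nat) (v u : cx_arr n) : cx_arr n :=
  if (j < 2)%N then cx_mk n (cx_ob v + cx_ob u) (cx_inc v + cx_inc u)
  else if j == 2%N then cx_mk n (cx_ob u) (cx_inc v + cx_inc u) else u.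

Definition complex_data : inf_cat_data :=
  InfCatData cx_src cx_tgt cx_idc cx_comp.

(** * Coordinates of the arrows of the complex *)

Lemma cx_obE n a b : cx_ob (cx_mk n a b) = if (n < 2)%N then 0 else a.
Proof. by case: n => [|[|[|n]]]. Qed.

Lemma cx_incE n a b : cx_inc (cx_mk n a b) = if (n < 3)%N then 0 else b.
Proof. by case: n => [|[|[|n]]]. Qed.

Lemma cx_ob_lt2 n (u : cx_arr n) : (n < 2)%N -> cx_ob u = 0.
Proof. by case: n u => [|[|n]]. Qed.

Lemma cx_inc_lt3 n (u : cx_arr n) : (n < 3)%N -> cx_inc u = 0.
Proof. by case: n u => [|[|[|n]]]. Qed.

(** Two coordinates determine an arrow in every dimension, so each axiom becomes a pair of equations
    in [A] and [B], computed by [cxE] uniformly in the dimension. *)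
Lemma cx_ext n (u v : cx_arr n) :
  cx_ob u = cx_ob v -> cx_inc u = cx_inc v -> u = v.
Proof.
by case: n u v => [|[|[|n]]] => [[] []|[] []|//|[a b] [a' b'] /= -> ->].
Qed.

Lemma cx_ob_src n (u : complex_data n.+1) :
  cx_ob (src u) = if (n < 2)%N then 0 else cx_ob u.
Proof. by rewrite cx_obE. Qed.

Lemma cx_inc_src n (u : complex_data n.+1) :
  cx_inc (src u) = if (n < 3)%N then 0 else cx_inc u.
Proof. by rewrite cx_incE. Qed.

Lemma cx_ob_tgt n (u : complex_data n.+1) :
  cx_ob (tgt u) = if (n < 2)%N then 0
                  else if n == 2%N then cx_ob u + bd (cx_inc u) else cx_ob u.
Proof. by rewrite cx_obE. Qed.

Lemma cx_inc_tgt n (u : complex_data n.+1) :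
  cx_inc (tgt u) = if (n < 3)%N then 0 else cx_inc u.
Proof. by rewrite cx_incE. Qed.

Lemma cx_ob_idc n (u : complex_data n) : cx_ob (idc u) = cx_ob u.
Proof. by rewrite cx_obE ltnS; case: n u => [|[|n]]. Qed.

Lemma cx_inc_idc n (u : complex_data n) : cx_inc (idc u) = cx_inc u.
Proof. by rewrite cx_incE ltnS; case: n u => [|[|[|n]]]. Qed.

Lemma cx_ob_comp n j (v u : complex_data n) :
  cx_ob (comp j v u) = if (j < 2)%N then cx_ob v + cx_ob u else cx_ob u.
Proof.
rewrite /comp /= /cx_comp; case: ifP => _; last case: ifP => _ //;
  rewrite cx_obE; case: ltnP => // n2; by rewrite !cx_ob_lt2 // addr0.
Qed.

Lemma cx_inc_comp n j (v u : complex_data n) :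
  cx_inc (comp j v u) = if (j < 3)%N then cx_inc v + cx_inc u else cx_inc u.
Proof.
rewrite /comp /= /cx_comp; case: ltnP => j2; last case: eqP => [->|j3] /=.
- rewrite ltnW // cx_incE; case: ltnP => // n2; by rewrite !cx_inc_lt3 // addr0.
- rewrite cx_incE; case: ltnP => // n2; by rewrite !cx_inc_lt3 // addr0.
- by case: ltnP => //; lia.
Qed.

Lemma cx_ob_srcn d j (u : complex_data (d + j)) :
  cx_ob (srcn d j u) = if (j < 2)%N then 0 else cx_ob u.
Proof.
elim: d u => [u|d IH u] /=; first by case: ltnP => // /cx_ob_lt2.
rewrite IH cx_ob_src; case: ltnP => // j2; case: ltnP => //.
by rewrite /addn; lia.
Qed.

Lemma cx_inc_srcn d j (u : complex_data (d + j)) :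
  cx_inc (srcn d j u) = if (j < 3)%N then 0 else cx_inc u.
Proof.
elim: d u => [u|d IH u] /=; first by case: ltnP => // /cx_inc_lt3.
rewrite IH cx_inc_src; case: ltnP => // j2; case: ltnP => //.
by rewrite /addn; lia.
Qed.

Lemma cx_ob_tgtn d j (u : complex_data (d + j)) :
  cx_ob (tgtn d j u) = if (j < 2)%N then 0
                  else if j == 2%N then cx_ob u + bd (cx_inc u) else cx_ob u.
Proof.
elim: d u => [u|d IH u] /=.
  case: ltnP => [/cx_ob_lt2 //|j2]; case: eqP => // e; subst j.
  by rewrite raddf0 addr0.
rewrite IH cx_ob_tgt; case: ltnP => // j2; case: (ltnP _ 2) => [|dj2].
  by rewrite /addn; lia.
case: (j =P 2) => [ej|nj]; last by case: eqP => //; rewrite /addn; lia.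
rewrite cx_inc_tgt; case: ltnP => dj3; last first.
  by case: eqP => // e; rewrite e in dj3.
by case: eqP; [rewrite raddf0 addr0|rewrite /addn in dj2 dj3 *; lia].
Qed.

Lemma cx_inc_tgtn d j (u : complex_data (d + j)) :
  cx_inc (tgtn d j u) = if (j < 3)%N then 0 else cx_inc u.
Proof.
elim: d u => [u|d IH u] /=; first by case: ltnP => // /cx_inc_lt3.
rewrite IH cx_inc_tgt; case: ltnP => // j2; case: ltnP => //.
by rewrite /addn; lia.
Qed.

Lemma cx_ob_idcn d j (u : complex_data j) : cx_ob (idcn d j u) = cx_ob u.
Proof. elim: d => //= d IH; exact: etrans (cx_ob_idc _) IH. Qed.

Lemma cx_inc_idcn d j (u : complex_data j) : cx_inc (idcn d j u) = cx_inc u.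
Proof. elim: d => //= d IH; exact: etrans (cx_inc_idc _) IH. Qed.

Definition cxE := (cx_ob_src, cx_inc_src, cx_ob_tgt, cx_inc_tgt, cx_ob_idc,
  cx_inc_idc, cx_ob_comp, cx_inc_comp, cx_ob_srcn, cx_inc_srcn, cx_ob_tgtn,
  cx_inc_tgtn, cx_ob_idcn, cx_inc_idcn).

(** There is one arrow in each dimension below 2, so composability has content only from [j = 2] on;
    above 2, boundaries keep both coordinates. *)
Lemma cx_composable d j (v u : complex_data (d + j)) : composable d j v u ->
  (j = 2%N -> cx_ob v = cx_ob u + bd (cx_inc u)) /\
  ((2 < j)%N -> cx_ob v = cx_ob u /\ cx_inc v = cx_inc u).
Proof.
move=> c; have := congr1 (@cx_ob j) c; have := congr1 (@cx_inc j) c.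
rewrite !cxE; case: j v u c => [|[|[|j]]] //= v u c; by [] || move=> ? ?; split.
Qed.

(** [bd] enters only for targets of 3-arrows; there [j < 2], both composites are sums, and [bd] is
    additive. *)
Lemma cx_tgt_comp n j (v u : complex_data n.+1) : (j < n)%N ->
  tgt (comp j v u) = comp j (tgt v) (tgt u).
Proof.
move=> jn; apply: cx_ext; rewrite !cxE.
  case: (ltnP n 2) => n2; first by case: ifP; rewrite ?addr0.
  case: eqP => [en|_] //; have j2 : (j < 2)%N by rewrite -en.
  by rewrite j2 ltnW // raddfD addrACA.
by case: (_ < _)%N; case: (j < 3)%N; rewrite ?addr0.
Qed.

Lemma complex_axioms : inf_cat_axioms complex_data.
Proof.
split.
- by move=> i u; apply: cx_ext; rewrite !cxE; case: i u => [|[|[|i]]].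
- by move=> i u; apply: cx_ext; rewrite !cxE; case: i u => [|[|[|i]]].
- by move=> j v u _; apply: cx_ext; rewrite !cxE; do ?case: ifP.
(* For [j = 2] this reads [a + bd (b' + b) = (a + bd b) + bd b']. *)
- move=> j v u e; have [] := @cx_composable 1 j v u e.
  by case: j v u e => [|[|[|j]]] v u _ c2 c3; apply: cx_ext; rewrite !cxE //=;
    [move: (c2 erefl) => /= ->; rewrite raddfD addrAC addrA|case: (c3 isT)..].
- move=> d j v u c; apply: cx_ext; rewrite !cxE.
    by case: (_ < _)%N; case: (j < 2)%N; rewrite ?addr0.
  by case: (_ < _)%N; case: (j < 3)%N; rewrite ?addr0.
- by move=> d j v u _; apply: (@cx_tgt_comp (d.+1 + j)); lia.
- by move=> i u; apply: cx_ext; rewrite !cxE; case: i u => [|[|[|i]]].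
- move=> i u; apply: cx_ext; rewrite !cxE; case: i u => [|[|[|i]]] //= u.
  by rewrite raddf0 addr0.
- move=> d j w v u c c'.
  by apply: cx_ext; rewrite !cxE; case: (_ < _)%N; rewrite ?addrA.
(* On each coordinate a composition is a sum or the right projection, and if it is a sum along [j],
   so it is along [k < j]; two sums commute with each other. *)
- move=> d e k j de ga be al _ _ _; have kj : (k < j)%N by rewrite /j; lia.
  apply: cx_ext; rewrite !cxE.
    case: (ltnP j 2) => j2; last by case: ifP.
    by rewrite (ltn_trans kj) // addrACA.
  case: (ltnP j 3) => j3; last by case: ifP.
  by rewrite (ltn_trans kj) // addrACA.
- by move=> d j u; apply: cx_ext; rewrite !cxE; case: (_ < _)%N; rewrite ?addr0.
- move=> d j u; apply: cx_ext; rewrite !cxE; case: (_ < _)%N; rewrite ?add0r //.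
- by move=> d j v u c; apply: cx_ext; rewrite !cxE.
Qed.

Definition complex_cat : inf_cat := InfCat complex_axioms.

(** Inverses are opposites for [j < 2] and reversed arrows, starting at the target of [u], for
    [j = 2]; higher up, units are their own inverses. *)
Definition cx_inv (n j : nat) (u : cx_arr n) : cx_arr n :=
  cx_mk n (if (j < 2)%N then - cx_ob u else
           if j == 2%N then cx_ob u + bd (cx_inc u) else cx_ob u)
          (if (j < 3)%N then - cx_inc u else cx_inc u).

Lemma cx_ob_inv n j (u : complex_data n) : (j < n)%N ->
  cx_ob (cx_inv j u) = if (j < 2)%N then - cx_ob u else
           if j == 2%N then cx_ob u + bd (cx_inc u) else cx_ob u.
Proof.
move=> jn; rewrite cx_obE; case: (ltnP n 2) => // n2.
by rewrite (ltn_trans jn) // cx_ob_lt2 // oppr0.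
Qed.

Lemma cx_inc_inv n j (u : complex_data n) : (j < n)%N ->
  cx_inc (cx_inv j u) = if (j < 3)%N then - cx_inc u else cx_inc u.
Proof.
move=> jn; rewrite cx_incE; case: (ltnP n 3) => // n2.
by rewrite (ltn_trans jn) // cx_inc_lt3 // oppr0.
Qed.

Lemma complex_strict_groupoid : strict_groupoid complex_cat.
Proof.
move=> d j u; exists (cx_inv j u); have jn : (j < d.+1 + j)%N by lia.
have := cx_ob_inv u jn; have := cx_inc_inv u jn.
move: (cx_inv j u : complex_data _) => v ev ov.
split; last split; last split; apply: cx_ext; rewrite !cxE ?ev ?ov;
  case: (ltnP j 2) => j2; case: (ltnP j 3) => j3; case: (j =P 2%N) => //= ej;
  rewrite ?addrN ?addNr ?raddfN ?addrK //; lia.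
Qed.

(** Above dimension 3 both [src] and [idc] keep the two coordinates, so an arrow is the unit of its
    source. *)
Lemma complex_units : units_above_3 complex_cat.
Proof.
move=> n u n3; exists (src u); apply: cx_ext; rewrite !cxE;
  by case: ltnP => //; lia.
Qed.

End Complex.

(** * Free abelian groups *)

Section FreeAbelianGroup.

Local Open Scope mset_scope.

Variable K : choiceType.

(* An element of the free abelian group on [K], as its positive and negative
   parts. *)
Record fab := Fab {
  fab_pair : {mset K} * {mset K};
  _ : fab_pair.1 `&` fab_pair.2 == mset0 }.

HB.instance Definition _ := [isSub for fab_pair].
HB.instance Definition _ := [Choice of fab by <:].

Definition fab_pos (a : fab) : {mset K} := (fab_pair a).1.
Definition fab_neg (a : fab) : {mset K} := (fab_pair a).2.

Lemma fab_disj a s : minn (fab_pos a s) (fab_neg a s) = 0%N.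
Proof.
case: a => p dp; have /msetP/(_ s) := eqP dp.
by rewrite msetE2 mset0E.
Qed.

Lemma fab_ext a b : fab_pos a =1 fab_pos b -> fab_neg a =1 fab_neg b -> a = b.
Proof.
move=> /msetP ep /msetP en; apply/val_inj => /=.
move: ep en; rewrite /fab_pos /fab_neg.
by case: (fab_pair a) (fab_pair b) => [? ?] [? ?] /= -> ->.
Qed.

Lemma fab_reduce_subproof (p n : {mset K}) : (p `\` n) `&` (n `\` p) == mset0.
Proof. by apply/eqP/msetP => s; rewrite !msetE2 mset0E; lia. Qed.

Definition fab_reduce (p n : {mset K}) : fab :=
  @Fab (p `\` n, n `\` p) (fab_reduce_subproof p n).

Definition fab_zero : fab := fab_reduce mset0 mset0.
Definition fab_opp (a : fab) : fab := fab_reduce (fab_neg a) (fab_pos a).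
Definition fab_add (a b : fab) : fab :=
  fab_reduce (fab_pos a `+` fab_pos b) (fab_neg a `+` fab_neg b).

(** Checked on multiplicities, where disjointness of the two parts leaves an identity of truncated
    subtraction. *)
Lemma fab_addA : associative fab_add.
Proof.
move=> a b c; apply: fab_ext => s; rewrite /fab_pos /fab_neg /= !msetE2;
  have := fab_disj a s; have := fab_disj b s; have := fab_disj c s;
  rewrite /fab_pos /fab_neg /= ?msetE2; lia.
Qed.

Lemma fab_addC : commutative fab_add.
Proof.
by move=> a b; apply: fab_ext => s; rewrite /fab_pos /fab_neg /= !msetE2; lia.
Qed.

Lemma fab_add0 : left_id fab_zero fab_add.
Proof.
move=> a; apply: fab_ext => s; rewrite /fab_pos /fab_neg /= !msetE2 !mset0E;
  have := fab_disj a s; rewrite /fab_pos /fab_neg; lia.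
Qed.

Lemma fab_addN : left_inverse fab_zero fab_opp fab_add.
Proof.
move=> a; apply: fab_ext => s; rewrite /fab_pos /fab_neg /= !msetE2 ?mset0E;
  rewrite /fab_pos /fab_neg; lia.
Qed.

HB.instance Definition _ :=
  GRing.isZmodule.Build fab fab_addA fab_addC fab_add0 fab_addN.

Lemma fab_pos_add a b s : fab_pos (a + b) s =
  (fab_pos a s + fab_pos b s - (fab_neg a s + fab_neg b s))%N.
Proof. by rewrite /fab_pos /= !msetE2. Qed.

Lemma fab_neg_add a b s : fab_neg (a + b) s =
  (fab_neg a s + fab_neg b s - (fab_pos a s + fab_pos b s))%N.
Proof. by rewrite /fab_neg /= !msetE2. Qed.

Lemma fab_pos0 : fab_pos 0 = mset0.
Proof. by apply/msetP => s; rewrite /fab_pos /= msetE2 mset0E. Qed.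

Lemma fab_neg0 : fab_neg 0 = mset0.
Proof. by apply/msetP => s; rewrite /fab_neg /= msetE2 mset0E. Qed.

Let msetDE (A B : {mset K}) s : (A `+` B) s = (A s + B s)%N.
Proof. by rewrite msetE2. Qed.

Let msetIE (A B : {mset K}) s : (A `&` B) s = minn (A s) (B s).
Proof. by rewrite msetE2. Qed.

Definition fab_gen (x : K) : fab := fab_reduce [mset x] mset0.

(** The pairs that disappear when the juxtaposed normal forms of [a] and [b] are reduced to that of
    [a + b]. *)
Definition cancelled (a b : fab) : {mset K} :=
  (fab_pos a `+` fab_pos b) `&` (fab_neg a `+` fab_neg b).

Lemma cancelledE a b s : cancelled a b s =
  minn (fab_pos a s + fab_pos b s)%N (fab_neg a s + fab_neg b s)%N.
Proof. by rewrite msetIE !msetDE. Qed.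

Lemma fab_pos_cancelled a b :
  fab_pos (a + b) `+` cancelled a b = fab_pos a `+` fab_pos b.
Proof. apply/msetP => s; rewrite !msetDE cancelledE fab_pos_add; lia. Qed.

Lemma fab_neg_cancelled a b :
  fab_neg (a + b) `+` cancelled a b = fab_neg a `+` fab_neg b.
Proof. apply/msetP => s; rewrite !msetDE cancelledE fab_neg_add; lia. Qed.

Lemma cancelledC a b : cancelled a b = cancelled b a.
Proof. by apply/msetP => s; rewrite !cancelledE; lia. Qed.

Lemma cancelled0 a : cancelled 0 a = mset0.
Proof.
apply/msetP => s.
by rewrite cancelledE fab_pos0 fab_neg0 mset0E !add0n fab_disj.
Qed.

(** Either side counts all the pairs lost in reducing three normal forms: the positive parts of [a],
    [b] and [c] minus that of [a + b + c]. This is what makes [mu] associative. *)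
Lemma cancelled_cocycle a b c :
  cancelled a (b + c) `+` cancelled b c = cancelled (a + b) c `+` cancelled a b.
Proof.
apply/msetP => s; rewrite !msetDE !cancelledE !fab_pos_add !fab_neg_add.
have := fab_disj a s; have := fab_disj b s; have := fab_disj c s; lia.
Qed.

(** Again both sides count the pairs lost in the total sum, now of four terms. *)
Lemma cancelledACA a b c d :
  cancelled (a + b) (c + d) `+` (cancelled a b `+` cancelled c d) =
  cancelled (a + c) (b + d) `+` (cancelled a c `+` cancelled b d).
Proof.
apply/msetP => s; rewrite !msetDE !cancelledE !fab_pos_add !fab_neg_add.
have := fab_disj a s; have := fab_disj b s; have := fab_disj c s.
have := fab_disj d s; lia.
Qed.

(** The enumeration of a sum of multisets is a permutation of the concatenated enumerations. *)
Lemma big_msetD (R : nmodType) (p q : {mset K}) (F : K -> R) :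
  (\sum_(s <- p `+` q) F s = \sum_(s <- p) F s + \sum_(s <- q) F s)%R.
Proof.
rewrite -big_cat; apply: perm_big; apply/eq_seq_msetP; rewrite seq_mset_id.
by apply/msetP => s; rewrite mset_seqE count_cat !count_mem_mset msetE2.
Qed.

End FreeAbelianGroup.

(** * Strictly commutative Picard groupoids *)

(* [pcmp g f] is only meaningful when [pdom g = pcod f]. *)
Record picard := Picard {
  pob : nmodType;
  pmor : nmodType;
  pdom : {additive pmor -> pob};
  pcod : {additive pmor -> pob};
  pid : {additive pob -> pmor};
  pcmp : pmor -> pmor -> pmor;
  pdom_id : forall x, pdom (pid x) = x;
  pcod_id : forall x, pcod (pid x) = x;
  pdom_cmp : forall g f, pdom g = pcod f -> pdom (pcmp g f) = pdom f;
  pcod_cmp : forall g f, pdom g = pcod f -> pcod (pcmp g f) = pcod g;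
  pcmpA : forall h g f, pdom h = pcod g -> pdom g = pcod f ->
    pcmp (pcmp h g) f = pcmp h (pcmp g f);
  pcmp_idl : forall f, pcmp (pid (pcod f)) f = f;
  pcmp_idr : forall f, pcmp f (pid (pdom f)) = f;
  pcmpD : forall g g' f f', pdom g = pcod f -> pdom g' = pcod f' ->
    pcmp (g + g') (f + f') = pcmp g f + pcmp g' f';
  pmor_inv : forall f, exists g, [/\ pdom g = pcod f, pcod g = pdom f,
    pcmp g f = pid (pdom f) & pcmp f g = pid (pcod f)];
  pob_inv : forall x, exists y f, pdom f = x + y /\ pcod f = 0
}.

Section Picard.

Variable P : picard.

Local Notation ob := (pob P).
Local Notation mor := (pmor P).
Local Notation dom := (@pdom P).
Local Notation cod := (@pcod P).
Local Notation id1 := (@pid P).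
Local Notation "g ** f" := (@pcmp P g f) (at level 40, left associativity).

Implicit Types (x y : ob) (f g h : mor).

(** * Interchange and inverses of arrows *)

Lemma pcmp_idlE x f : x = cod f -> id1 x ** f = f.
Proof. by move=> ->; apply: pcmp_idl. Qed.

Lemma pcmp_idrE x f : x = dom f -> f ** id1 x = f.
Proof. by move=> ->; apply: pcmp_idr. Qed.

(** By interchange and the unit laws, a sum can be performed one summand at a time, here [g] before
    [f]. *)
Lemma paddE f g : f + g = (f + id1 (cod g)) ** (id1 (dom f) + g).
Proof. by rewrite pcmpD ?pcod_id ?pdom_id // pcmp_idl pcmp_idr. Qed.

Lemma padd_cmpr f g h : dom h = cod g ->
  f + h ** g = (id1 (cod f) + h) ** (f + g).
Proof. by move=> hg; rewrite pcmpD ?pdom_id // pcmp_idl. Qed.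

Lemma padd_cmpl f g h : dom h = cod g ->
  h ** g + f = (h + id1 (cod f)) ** (g + f).
Proof. by move=> hg; rewrite pcmpD ?pdom_id // pcmp_idl. Qed.

Definition pinv f : mor := sval (cid (pmor_inv f)).

Lemma pdom_inv f : dom (pinv f) = cod f.
Proof. by rewrite /pinv; case: cid => g []. Qed.

Lemma pcod_inv f : cod (pinv f) = dom f.
Proof. by rewrite /pinv; case: cid => g []. Qed.

Lemma pcmpVf f : pinv f ** f = id1 (dom f).
Proof. by rewrite /pinv; case: cid => g []. Qed.

Lemma pcmpfV f : f ** pinv f = id1 (cod f).
Proof. by rewrite /pinv; case: cid => g []. Qed.

Lemma pdomD f g : dom (f + g) = dom f + dom g. Proof. exact: raddfD. Qed.
Lemma pcodD f g : cod (f + g) = cod f + cod g. Proof. exact: raddfD. Qed.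
Lemma pdom0 : dom 0 = 0. Proof. exact: raddf0. Qed.
Lemma pcod0 : cod 0 = 0. Proof. exact: raddf0. Qed.

Definition pdcE :=
  (pdom_inv, pcod_inv, pdom_id, pcod_id, pdomD, pcodD, pdom0, pcod0).

Lemma pinv_unique f g : dom g = cod f -> cod g = dom f ->
  g ** f = id1 (dom f) -> g = pinv f.
Proof.
move=> gf fg e; rewrite -[LHS]pcmp_idr gf -pcmpfV -pcmpA ?pdcE //.
by rewrite e pcmp_idlE // pdcE.
Qed.

Lemma pinv_id x : pinv (id1 x) = id1 x.
Proof. by apply/esym/pinv_unique; rewrite ?pdcE // pcmp_idlE ?pdcE. Qed.

Lemma pinvD f g : pinv (f + g) = pinv f + pinv g.
Proof.
apply/esym/pinv_unique; rewrite ?pdcE //.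
by rewrite pcmpD ?pdcE // !pcmpVf ?pdomD raddfD.
Qed.

Lemma pinv_cmp g f : dom g = cod f -> pinv (g ** f) = pinv f ** pinv g.
Proof.
move=> gf; have fg : dom (pinv f) = cod (pinv g) by rewrite !pdcE.
apply/esym/pinv_unique; rewrite ?pdom_cmp ?pcod_cmp ?pdcE //.
rewrite pcmpA ?pcod_cmp ?pdcE // -[pinv g ** _]pcmpA ?pdcE // pcmpVf gf.
by rewrite pcmp_idl pcmpVf.
Qed.

(** Inverting two opposite sides of a commutative square; properties of [mu] are carried over in
    this way to its inverse [nu]. *)
Lemma pinv_square f g h k : dom f = cod g -> dom h = cod k ->
  cod f = cod h -> dom g = dom k ->
  f ** g = h ** k -> pinv h ** f = k ** pinv g.
Proof.
move=> fg hk fh gk e.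
have -> : f = h ** k ** pinv g.
  by rewrite -e pcmpA ?pdcE // pcmpfV pcmp_idrE.
rewrite -!pcmpA ?pdcE ?pcod_cmp ?pdom_cmp ?pdcE //.
by rewrite pcmpVf hk pcmp_idl.
Qed.

(** * Duals and cancellation of pairs *)

Definition dual x : ob := sval (cid (pob_inv x)).
Definition ev x : mor := sval (cid (svalP (cid (pob_inv x)))).

Lemma pdom_ev x : dom (ev x) = x + dual x.
Proof. by have [] := svalP (cid (svalP (cid (pob_inv x)))). Qed.

Lemma pcod_ev x : cod (ev x) = 0.
Proof. by have [] := svalP (cid (svalP (cid (pob_inv x)))). Qed.

Definition msum (k : {mset ob}%mset) : ob := \sum_(x <- k) x.
Definition mdual (k : {mset ob}%mset) : ob := \sum_(x <- k) dual x.

(* [collapse x k] cancels the pairs [y + dual y], for [y] in [k], next to [x].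
   Since [+] is strictly commutative, these arrows are closed under sums and
   composites, so that parallel ones are equal as soon as their [k] are. *)
Definition collapse x (k : {mset ob}%mset) : mor := id1 x + \sum_(y <- k) ev y.

Lemma pdom_collapse x k : dom (collapse x k) = x + (msum k + mdual k).
Proof.
rewrite /collapse raddfD pdom_id raddf_sum /msum /mdual -big_split /=.
by congr (_ + _); apply: eq_bigr => y _; rewrite pdom_ev.
Qed.

Lemma pcod_collapse x k : cod (collapse x k) = x.
Proof.
rewrite /collapse raddfD pcod_id raddf_sum big1 ?addr0 // => y _.
exact: pcod_ev.
Qed.

Lemma collapse0 x : collapse x mset0 = id1 x.
Proof. by rewrite /collapse enum_mset0 big_nil addr0. Qed.

Lemma collapseD x y k l :
  collapse x k + collapse y l = collapse (x + y) (k `+` l)%mset.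
Proof. by rewrite /collapse big_msetD raddfD addrACA. Qed.

(** The sum of [ev] over [l] ends at [0], so by [paddE] adding it to the sum over [k] amounts to
    performing it first. *)
Lemma collapse_cmp x y k l : y = x + (msum k + mdual k) ->
  collapse x k ** collapse y l = collapse x (k `+` l)%mset.
Proof.
move=> ->; have cl : cod (\sum_(y <- l) ev y) = 0.
  by have := pcod_collapse 0 l; rewrite /collapse !pdcE add0r.
have dk : dom (\sum_(y <- k) ev y) = msum k + mdual k.
  by have := pdom_collapse 0 k; rewrite /collapse !pdcE !add0r.
rewrite /collapse big_msetD -dk.
move: (\sum_(s <- k) _) (\sum_(s <- l) _) cl => f g g0.
rewrite [id1 (_ + _)]raddfD -addrA pcmpD ?pdcE ?g0 ?addr0 //.
rewrite pcmp_idlE ?pdcE //; congr (_ + _).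
by rewrite [RHS]paddE g0 raddf0 addr0.
Qed.

(** * Realization of formal sums and its comparison arrows *)

Local Notation A := (fab ob).
Implicit Types (a b c d : A).

(* Locked, as is [mu], because rewriting with lemmas on sums would otherwise
   look inside it. *)
Definition real a : ob := locked (msum (fab_pos a) + mdual (fab_neg a)).

Lemma real0 : real 0 = 0.
Proof.
rewrite /real -lock fab_pos0 fab_neg0 /msum /mdual.
by rewrite enum_mset0 !big_nil addr0.
Qed.

Lemma msumD k l : msum (k `+` l)%mset = msum k + msum l.
Proof. exact: big_msetD. Qed.

Lemma mdualD k l : mdual (k `+` l)%mset = mdual k + mdual l.
Proof. exact: big_msetD. Qed.

(** Two juxtaposed realizations contain that of the sum and the cancelled pairs [x + dual x]; hence
    the [collapse] defining [mu a b] starts at [real a + real b]. *)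
Lemma real_cancelled a b : real (a + b) +
  (msum (cancelled a b) + mdual (cancelled a b)) = real a + real b.
Proof.
rewrite /real -!lock addrACA -msumD -mdualD fab_pos_cancelled fab_neg_cancelled.
by rewrite msumD mdualD addrACA.
Qed.

(** Every object is thus strictly a realization, whence surjectivity on the second homotopy
    group. *)
Lemma real_gen x : real (fab_gen x) = x.
Proof.
rewrite /real -lock; have -> : fab_pos (fab_gen x) = [mset x]%mset.
  by apply/msetP => s; rewrite /fab_pos /= msetE2 mset0E subn0.
have -> : fab_neg (fab_gen x) = mset0.
  by apply/msetP => s; rewrite /fab_neg /= msetE2 mset0E.
by rewrite /msum /mdual enum_mset0 big_nil enum_msetn big_seq1 addr0.
Qed.

Definition mu a b : mor := locked (collapse (real (a + b)) (cancelled a b)).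

Lemma pdom_mu a b : dom (mu a b) = real a + real b.
Proof. by rewrite /mu -lock pdom_collapse real_cancelled. Qed.

Lemma pcod_mu a b : cod (mu a b) = real (a + b).
Proof. by rewrite /mu -lock pcod_collapse. Qed.

Lemma muC a b : mu a b = mu b a.
Proof. by rewrite /mu addrC cancelledC. Qed.

Lemma mu0l a : mu 0 a = id1 (real a).
Proof. by rewrite /mu -lock cancelled0 collapse0 add0r. Qed.

Lemma mu0r a : mu a 0 = id1 (real a).
Proof. by rewrite muC mu0l. Qed.

(** Identities are collapses of the empty multiset, so both sides are collapses onto one object,
    with multisets identified by [cancelled_cocycle]. *)
Lemma mu_assoc a b c : mu a (b + c) ** (id1 (real a) + mu b c) =
  mu (a + b) c ** (mu a b + id1 (real c)).
Proof.
rewrite /mu -!lock -!collapse0 !collapseD !collapse_cmp ?real_cancelled //.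
by rewrite mset0D msetD0 addrA cancelled_cocycle.
Qed.

(** The same argument with [cancelledACA]. Since [*0] and [*1] both become sums, this is the
    compatibility of [mu] with the exchange law. *)
Lemma mu_ACA a b c d : mu (a + b) (c + d) ** (mu a b + mu c d) =
  mu (a + c) (b + d) ** (mu a c + mu b d).
Proof.
rewrite /mu -!lock !collapseD !collapse_cmp ?real_cancelled //.
by rewrite addrACA cancelledACA.
Qed.

Definition nu a b : mor := pinv (mu a b).

Lemma pdom_nu a b : dom (nu a b) = real (a + b).
Proof. by rewrite /nu pdcE pcod_mu. Qed.

Lemma pcod_nu a b : cod (nu a b) = real a + real b.
Proof. by rewrite /nu pdcE pdom_mu. Qed.

Definition muE := (pdom_mu, pcod_mu, pdom_nu, pcod_nu, pdcE, real0).

Lemma nu_assoc a b c : (nu a b + id1 (real c)) ** nu (a + b) c =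
  (id1 (real a) + nu b c) ** nu a (b + c).
Proof.
rewrite -[id1 (real c)]pinv_id -[id1 (real a)]pinv_id.
rewrite -!pinvD -!pinv_cmp ?muE //.
by rewrite (mu_assoc a b c).
Qed.

(* The arrows [0 -> real c]; the arrow [cone_mor u] stands for the whole family
   of its translates. *)
Record cone := Cone {
  cone_pair : A * mor;
  _ : (dom cone_pair.2 == 0) && (cod cone_pair.2 == real cone_pair.1) }.

HB.instance Definition _ := [isSub for cone_pair].
HB.instance Definition _ := [Choice of cone by <:].

Definition cone_ob (u : cone) : A := (cone_pair u).1.
Definition cone_mor (u : cone) : mor := (cone_pair u).2.

Lemma pdom_cone u : dom (cone_mor u) = 0.
Proof. by case: u => p pP; case/andP: (pP) => /eqP. Qed.

Lemma pcod_cone u : cod (cone_mor u) = real (cone_ob u).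
Proof. by case: u => p pP; case/andP: (pP) => _ /eqP. Qed.

Lemma mk_cone_subproof c f : dom f = 0 -> cod f = real c ->
  (dom (c, f).2 == 0) && (cod (c, f).2 == real (c, f).1).
Proof. by move=> -> -> /=; rewrite !eqxx. Qed.

Definition mk_cone c f (df : dom f = 0) (cf : cod f = real c) : cone :=
  Cone (mk_cone_subproof df cf).

Lemma cone_ext u v : cone_ob u = cone_ob v -> cone_mor u = cone_mor v -> u = v.
Proof.
rewrite /cone_ob /cone_mor => e1 e2; apply/val_inj => /=.
by move: e1 e2; case: (cone_pair u) (cone_pair v) => [? ?] [? ?] /= -> ->.
Qed.

Definition coneE := (pdom_cone, pcod_cone, muE).

Lemma cone_zero_dom : dom 0 = 0. Proof. exact: raddf0. Qed.
Lemma cone_zero_cod : cod 0 = real 0. Proof. by rewrite real0 raddf0. Qed.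
Definition cone_zero : cone := mk_cone cone_zero_dom cone_zero_cod.

Definition cone_add_mor u v : mor :=
  mu (cone_ob u) (cone_ob v) ** (cone_mor u + cone_mor v).

Lemma cone_add_dom u v : dom (cone_add_mor u v) = 0.
Proof. by rewrite pdom_cmp ?coneE ?addr0. Qed.
Lemma cone_add_cod u v : cod (cone_add_mor u v) = real (cone_ob u + cone_ob v).
Proof. by rewrite pcod_cmp ?coneE. Qed.
Definition cone_add u v : cone := mk_cone (cone_add_dom u v) (cone_add_cod u v).

(** With [c = cone_ob u], the composite [0 = real (c - c) -> real c + real (- c) -> real (- c)],
    whose second arrow undoes [cone_mor u]. *)
Definition cone_opp_mor u : mor :=
  (pinv (cone_mor u) + id1 (real (- cone_ob u))) **
  nu (cone_ob u) (- cone_ob u).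

Lemma cone_opp_dom u : dom (cone_opp_mor u) = 0.
Proof. by rewrite pdom_cmp ?coneE ?addrN ?real0. Qed.
Lemma cone_opp_cod u : cod (cone_opp_mor u) = real (- cone_ob u).
Proof. by rewrite pcod_cmp ?coneE ?add0r. Qed.
Definition cone_opp u : cone := mk_cone (cone_opp_dom u) (cone_opp_cod u).

Lemma cone_ob_add u v : cone_ob (cone_add u v) = cone_ob u + cone_ob v.
Proof. by []. Qed.

Lemma cone_mor_add u v : cone_mor (cone_add u v) =
  mu (cone_ob u) (cone_ob v) ** (cone_mor u + cone_mor v).
Proof. by []. Qed.

Lemma cone_addC : commutative cone_add.
Proof.
move=> u v; apply: cone_ext; first exact: addrC.
by rewrite !cone_mor_add muC addrC.
Qed.

Lemma cone_add0 : left_id cone_zero cone_add.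
Proof.
move=> u; apply: cone_ext; first exact: add0r.
by rewrite cone_mor_add mu0l add0r pcmp_idlE // pcod_cone.
Qed.

Lemma cone_addA : associative cone_add.
Proof.
move=> u v w; apply: cone_ext; first exact: addrA.
rewrite !cone_mor_add !cone_ob_add.
rewrite padd_cmpr ?coneE // padd_cmpl ?coneE // -!pcmpA ?coneE ?addrA //.
by rewrite mu_assoc.
Qed.

Lemma cone_addN : left_inverse cone_zero cone_opp cone_add.
Proof.
move=> u; rewrite -[cone_add _ _]cone_addC; apply: cone_ext; first exact: addrN.
rewrite cone_mor_add [cone_mor cone_zero]/(0 : mor).
have -> : cone_mor (cone_opp u) = (pinv (cone_mor u) + id1 (real (- cone_ob u)))
  ** nu (cone_ob u) (- cone_ob u) by [].
have -> : cone_ob (cone_opp u) = - cone_ob u by [].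
(* As [cone_mor u] starts at [0], its sum with its inverse is also their composite. *)
have TV : cone_mor u + pinv (cone_mor u) = id1 (real (cone_ob u)).
  by rewrite paddE ?coneE raddf0 addr0 add0r pcmpfV pcod_cone.
move: (cone_ob u) (cone_mor u) (pdom_cone u) (pcod_cone u) TV => c T dT cT TV.
(* Writing [T] as a composite with the identity of [0], interchange brings [T] next to its
   inverse. *)
have -> : T + (pinv T + id1 (real (- c))) ** nu c (- c) = nu c (- c).
  rewrite -{1}[T]pcmp_idr -pcmpD ?muE ?dT ?cT ?add0r //.
  by rewrite raddf0 add0r addrA TV -raddfD pcmp_idlE // muE.
by rewrite pcmpfV muE addrN real0 raddf0.
Qed.

HB.instance Definition _ :=
  GRing.isZmodule.Build cone cone_addA cone_addC cone_add0 cone_addN.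

Lemma cone_obD u v : cone_ob (u + v) = cone_ob u + cone_ob v.
Proof. by []. Qed.

Lemma cone_morD u v : cone_mor (u + v) =
  mu (cone_ob u) (cone_ob v) ** (cone_mor u + cone_mor v).
Proof. by []. Qed.

(** This makes [cone_ob] the boundary map of the complex. *)
Fact cone_ob_is_nmod_morphism : nmod_morphism cone_ob.
Proof. by split. Qed.

HB.instance Definition _ :=
  GRing.isNmodMorphism.Build cone A cone_ob cone_ob_is_nmod_morphism.

(** The translate of the cone [u] to [real a], which is the image in [P] of the 3-arrow [(a, u)] of
    the complex. *)
Definition push a u : mor := mu a (cone_ob u) ** (id1 (real a) + cone_mor u).

Lemma pdom_push a u : dom (push a u) = real a.
Proof. by rewrite pdom_cmp ?coneE ?addr0. Qed.

Lemma pcod_push a u : cod (push a u) = real (a + cone_ob u).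
Proof. by rewrite pcod_cmp ?coneE. Qed.

Lemma push0 a : push a 0 = id1 (real a).
Proof. by rewrite /push raddf0 mu0r addr0 pcmp_idlE // pcod_id. Qed.

Lemma push_zero u : push 0 u = cone_mor u.
Proof. by rewrite /push mu0l real0 raddf0 add0r pcmp_idlE // pcod_cone. Qed.

(** A cone starts at [0], so by interchange performing it beside the target of [f], after [f], is
    adding it to [f]. *)
Lemma pshift_cmp x f u : x = cod f ->
  (id1 x + cone_mor u) ** f = f + cone_mor u.
Proof.
move=> ->; rewrite -[X in _ ** X]addr0 -[0](raddf0 id1) -(pdom_cone u).
by rewrite pcmpD ?pdcE // pcmp_idl pcmp_idr.
Qed.

(** Cones are added through [mu], so this follows from [mu_assoc]; it makes the pseudo-functor
    preserve [*2]. *)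
Lemma push_cmp a u v : push (a + cone_ob u) v ** push a u = push a (v + u).
Proof.
rewrite [v + u]addrC /push cone_obD cone_morD padd_cmpr ?coneE //.
rewrite -[RHS]pcmpA ?coneE // mu_assoc pcmpA ?coneE //; last first.
  by rewrite pcod_cmp ?coneE ?addr0.
rewrite pshift_cmp ?pcod_cmp ?coneE // padd_cmpl ?coneE // -addrA.
by rewrite -pcmpA ?coneE ?addrA.
Qed.

(** Naturality of [mu] with respect to 3-arrows, an instance of [mu_ACA] with the boundaries of [u]
    and [v]. *)
Lemma push_mu b a u v :
  mu (b + cone_ob u) (a + cone_ob v) ** (push b u + push a v) =
  push (b + a) (u + v) ** mu b a.
Proof.
rewrite [push (b + a) _]/push pcmpA ?coneE ?addr0 //.
rewrite pshift_cmp ?coneE // cone_obD cone_morD -[mu b a]pcmp_idr.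
rewrite -[in RHS]pcmpD ?coneE // -[RHS]pcmpA ?coneE //.
rewrite mu_ACA /push -[in LHS]pcmpD ?coneE // -pcmpA ?coneE //.
by congr (_ ** _); rewrite addrACA raddfD.
Qed.

(** Adding the identity of [real (- a)] turns [f] into an arrow [0 = real (a - a) -> real (b - a)],
    that is, a cone with boundary [b - a]. *)
Lemma cone_lift a b f : dom f = real a -> cod f = real b ->
  exists u, a + cone_ob u = b.
Proof.
move=> df cf; pose g := mu b (- a) ** ((f + id1 (real (- a))) ** nu a (- a)).
have dg : dom g = 0.
  by rewrite !(pdom_cmp, pcod_cmp) ?muE ?df ?cf // addrN real0.
have cg : cod g = real (b - a).
  by rewrite !(pdom_cmp, pcod_cmp) ?muE ?df ?cf.
by exists (mk_cone dg cg); rewrite [cone_ob _]/(b - a) addrC subrK.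
Qed.

End Picard.

Local Close Scope ring_scope.

(** * The Picard groupoid of loops at an object *)

Lemma weakly_homotopic_hom (C : inf_cat_data) n (x y : C n) :
  weakly_homotopic x y -> exists u, hom x y u.
Proof. by case=> {}n {}x {}y u h _; exists u. Qed.

(** One unfolding of the coinductive definition is enough, because every arrow of a quasi-strict
    groupoid is weakly invertible. *)
Lemma weakly_invertible_inv (C : inf_cat_data) n (u : C n.+1) :
  weakly_invertible u -> exists v w1 w2, [/\ hom (tgt u) (src u) v,
    hom (comp n u v) (idc (tgt u)) w1 & hom (comp n v u) (idc (src u)) w2].
Proof.
case=> {}n x y {}u v [<- <-] hv /weakly_homotopic_hom[w1 h1].
by move=> /weakly_homotopic_hom[w2 h2]; exists v, w1, w2.
Qed.

(** A homotopy between arrows of dimension at least 3 is a unit, so its two ends coincide. *)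
Lemma units_above_3_homotopic (C : inf_cat) : units_above_3 C ->
  forall n (x y : C n), 2 < n -> homotopic x y -> x = y.
Proof.
move=> C3 n x y n3 [u [<- <-]]; have [|v ->] := C3 n u; first by apply/ltP.
by rewrite (src_idc (inf_catP C)) (tgt_idc (inf_catP C)).
Qed.

Lemma homotopic_refl (C : inf_cat) n (x : C n) : homotopic x x.
Proof.
by exists (idc x); rewrite /hom (src_idc (inf_catP C)) (tgt_idc (inf_catP C)).
Qed.

Lemma homotopic_sym (C : inf_cat_data) n (x y : C n) :
  quasi_strict_groupoid C -> homotopic x y -> homotopic y x.
Proof.
move=> Cq [u [<- <-]].
by have [v [_ [_ [hv _ _]]]] := weakly_invertible_inv (Cq n u); exists v.
Qed.

Lemma homotopic_trans (C : inf_cat) n (x y z : C n) :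
  homotopic x y -> homotopic y z -> homotopic x z.
Proof.
case=> u [ux uy] [v [vy vz]]; exists (comp n v u).
by split; rewrite ?(src_comp_top (inf_catP C)) ?(tgt_comp_top (inf_catP C)) ?uy.
Qed.

Lemma loop_units (C : inf_cat) (x : C 0) n (u : C n.+1) : units_above_3 C ->
  2 < n -> loop x u -> u = idobj n.+1 x.
Proof.
move=> C3 n2 [us _]; have [|v e] := C3 n u; first by apply/ltP.
by rewrite /= -us e (src_idc (inf_catP C)).
Qed.

Lemma idobj_loop (C : inf_cat) (x : C 0) n : loop x (idobj n.+1 x).
Proof.
by split; rewrite /= ?(src_idc (inf_catP C)) ?(tgt_idc (inf_catP C)).
Qed.

Lemma idobj_comp (C : inf_cat) (x : C 0) n :
  comp n (idobj n.+1 x) (idobj n.+1 x) = idobj n.+1 x.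
Proof.
have := @comp_idcl _ (inf_catP C) 0 n (idobj n.+1 x).
by rewrite /= (tgt_idc (inf_catP C)).
Qed.

Section Loops.

Variables (G : inf_cat) (x0 : G 0).

Local Notation o1 := (idc x0).
Local Notation o2 := (idc (idc x0)).
Local Notation o3 := (idc (idc (idc x0))).

Let ax : inf_cat_axioms G := inf_catP G.

Record loop2 := Loop2 {
  loop2_arr : G 2;
  loop2_src : src loop2_arr = o1; loop2_tgt : tgt loop2_arr = o1 }.

(** The conditions bear on the source only; globularity gives those on the target. *)
Record loop3 := Loop3 {
  loop3_arr : G 3;
  loop3_src : src (src loop3_arr) = o1; loop3_tgt : tgt (src loop3_arr) = o1 }.

HB.instance Definition _ := gen_eqMixin loop2.
HB.instance Definition _ := gen_choiceMixin loop2.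
HB.instance Definition _ := gen_eqMixin loop3.
HB.instance Definition _ := gen_choiceMixin loop3.

Lemma loop2_ext a b : loop2_arr a = loop2_arr b -> a = b.
Proof.
case: a b => [a s t] [b s' t'] /= e; subst b.
by congr Loop2; apply: Prop_irrelevance.
Qed.

Lemma loop3_ext a b : loop3_arr a = loop3_arr b -> a = b.
Proof.
case: a b => [a s t] [b s' t'] /= e; subst b.
by congr Loop3; apply: Prop_irrelevance.
Qed.

Lemma src_tgt_loop3 f : src (tgt (loop3_arr f)) = o1.
Proof. by rewrite -(src_src ax) loop3_src. Qed.

Lemma tgt_tgt_loop3 f : tgt (tgt (loop3_arr f)) = o1.
Proof. by rewrite -(tgt_tgt ax) loop3_tgt. Qed.

Definition loop2E := (loop2_src, loop2_tgt).
Definition loop3E := (loop3_src, loop3_tgt, src_tgt_loop3, tgt_tgt_loop3).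
Let idE := (src_idc ax, tgt_idc ax).

Lemma loop2_0_src : src o2 = o1. Proof. by rewrite idE. Qed.
Lemma loop2_0_tgt : tgt o2 = o1. Proof. by rewrite idE. Qed.
Definition loop2_0 := Loop2 loop2_0_src loop2_0_tgt.

Lemma loop3_0_src : src (src o3) = o1. Proof. by rewrite !idE. Qed.
Lemma loop3_0_tgt : tgt (src o3) = o1. Proof. by rewrite !idE. Qed.
Definition loop3_0 := Loop3 loop3_0_src loop3_0_tgt.

Lemma loop2_add_src a b : src (comp 1 (loop2_arr a) (loop2_arr b)) = o1.
Proof. by rewrite (src_comp_top ax) ?loop2E. Qed.
Lemma loop2_add_tgt a b : tgt (comp 1 (loop2_arr a) (loop2_arr b)) = o1.
Proof. by rewrite (tgt_comp_top ax) ?loop2E. Qed.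
Definition loop2_add a b := Loop2 (loop2_add_src a b) (loop2_add_tgt a b).

Lemma loop3_composable f g : composable 2 1 (loop3_arr f) (loop3_arr g).
Proof. by rewrite /composable /= !loop3E. Qed.

Lemma src_loop3_add f g : src (comp 1 (loop3_arr f) (loop3_arr g)) =
  comp 1 (src (loop3_arr f)) (src (loop3_arr g)).
Proof. exact: (@src_comp _ ax 0 1 _ _ (loop3_composable f g)). Qed.

Lemma tgt_loop3_add f g : tgt (comp 1 (loop3_arr f) (loop3_arr g)) =
  comp 1 (tgt (loop3_arr f)) (tgt (loop3_arr g)).
Proof. exact: (@tgt_comp _ ax 0 1 _ _ (loop3_composable f g)). Qed.

Lemma loop3_add_src f g : src (src (comp 1 (loop3_arr f) (loop3_arr g))) = o1.
Proof. by rewrite src_loop3_add (src_comp_top ax) ?loop3E. Qed.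
Lemma loop3_add_tgt f g : tgt (src (comp 1 (loop3_arr f) (loop3_arr g))) = o1.
Proof. by rewrite src_loop3_add (tgt_comp_top ax) ?loop3E. Qed.
Definition loop3_add f g := Loop3 (loop3_add_src f g) (loop3_add_tgt f g).

Lemma loop2_addA : associative loop2_add.
Proof.
move=> a b c; apply/loop2_ext/esym.
by apply: (@comp_assoc _ ax 0 1); rewrite /composable /= !loop2E.
Qed.

Lemma loop3_addA : associative loop3_add.
Proof.
move=> a b c; apply/loop3_ext/esym.
by apply: (@comp_assoc _ ax 1 1); rewrite /composable /= !loop3E.
Qed.

Lemma loop2_idl a : comp 1 o2 (loop2_arr a) = loop2_arr a.
Proof. by have := @comp_idcl _ ax 0 1 (loop2_arr a); rewrite /= loop2E. Qed.

Lemma loop2_idr a : comp 1 (loop2_arr a) o2 = loop2_arr a.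
Proof. by have := @comp_idcr _ ax 0 1 (loop2_arr a); rewrite /= loop2E. Qed.

(** [o2] is an iterated unit of [x0], hence neutral for [*0] as well as for [*1], as the
    Eckmann-Hilton argument requires. *)
Lemma loop2_idl0 a : comp 0 o2 (loop2_arr a) = loop2_arr a.
Proof. by have := @comp_idcl _ ax 1 0 (loop2_arr a); rewrite /= loop2E idE. Qed.

Lemma loop2_idr0 a : comp 0 (loop2_arr a) o2 = loop2_arr a.
Proof. by have := @comp_idcr _ ax 1 0 (loop2_arr a); rewrite /= loop2E idE. Qed.

Lemma loop3_idl f : comp 1 o3 (loop3_arr f) = loop3_arr f.
Proof. by have := @comp_idcl _ ax 1 1 (loop3_arr f); rewrite /= loop3E. Qed.

Lemma loop3_idr f : comp 1 (loop3_arr f) o3 = loop3_arr f.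
Proof. by have := @comp_idcr _ ax 1 1 (loop3_arr f); rewrite /= loop3E. Qed.

Lemma loop3_idl0 f : comp 0 o3 (loop3_arr f) = loop3_arr f.
Proof. by have := @comp_idcl _ ax 2 0 (loop3_arr f); rewrite /= loop3E idE. Qed.

Lemma loop3_idr0 f : comp 0 (loop3_arr f) o3 = loop3_arr f.
Proof. by have := @comp_idcr _ ax 2 0 (loop3_arr f); rewrite /= loop3E idE. Qed.

(* The two halves of the Eckmann-Hilton argument. *)
Lemma comp0_loop2 a b :
  comp 0 (loop2_arr a) (loop2_arr b) = comp 1 (loop2_arr a) (loop2_arr b).
Proof.
have := @exchange _ ax 0 0 0 (loop2_arr a) o2 o2 (loop2_arr b).
rewrite /= /composable /= !loop2E !idE loop2_idr loop2_idl.
by rewrite loop2_idr0 loop2_idl0; apply.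
Qed.

Lemma comp0_loop2C a b :
  comp 0 (loop2_arr a) (loop2_arr b) = comp 1 (loop2_arr b) (loop2_arr a).
Proof.
have := @exchange _ ax 0 0 0 o2 (loop2_arr a) (loop2_arr b) o2.
rewrite /= /composable /= !loop2E !idE loop2_idr loop2_idl.
by rewrite loop2_idr0 loop2_idl0; apply.
Qed.

Lemma comp0_loop3 f g :
  comp 0 (loop3_arr f) (loop3_arr g) = comp 1 (loop3_arr f) (loop3_arr g).
Proof.
have := @exchange _ ax 1 0 0 (loop3_arr f) o3 o3 (loop3_arr g).
rewrite /= /composable /= !loop3E !idE loop3_idr loop3_idl.
by rewrite loop3_idr0 loop3_idl0; apply.
Qed.

Lemma comp0_loop3C f g :
  comp 0 (loop3_arr f) (loop3_arr g) = comp 1 (loop3_arr g) (loop3_arr f).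
Proof.
have := @exchange _ ax 1 0 0 o3 (loop3_arr f) (loop3_arr g) o3.
rewrite /= /composable /= !loop3E !idE loop3_idr loop3_idl.
by rewrite loop3_idr0 loop3_idl0; apply.
Qed.

Lemma loop2_addC : commutative loop2_add.
Proof.
by move=> a b; apply: loop2_ext; rewrite /= -comp0_loop2 comp0_loop2C.
Qed.

Lemma loop3_addC : commutative loop3_add.
Proof.
by move=> a b; apply: loop3_ext; rewrite /= -comp0_loop3 comp0_loop3C.
Qed.

Lemma loop2_add0 : left_id loop2_0 loop2_add.
Proof. by move=> a; apply: loop2_ext; rewrite /= loop2_idl. Qed.

Lemma loop3_add0 : left_id loop3_0 loop3_add.
Proof. by move=> a; apply: loop3_ext; rewrite /= loop3_idl. Qed.

HB.instance Definition _ :=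
  GRing.isNmodule.Build loop2 loop2_addA loop2_addC loop2_add0.
HB.instance Definition _ :=
  GRing.isNmodule.Build loop3 loop3_addA loop3_addC loop3_add0.

Lemma loop3D (f g : loop3) :
  loop3_arr (f + g)%R = comp 1 (loop3_arr f) (loop3_arr g).
Proof. by []. Qed.

Definition loop3_dom f := Loop2 (loop3_src f) (loop3_tgt f).
Definition loop3_cod f := Loop2 (src_tgt_loop3 f) (tgt_tgt_loop3 f).

Fact loop3_dom_nmod_morphism : nmod_morphism loop3_dom.
Proof.
split; first by apply: loop2_ext; rewrite /= idE.
by move=> f g; apply: loop2_ext; rewrite /= src_loop3_add.
Qed.

HB.instance Definition _ :=
  GRing.isNmodMorphism.Build loop3 loop2 loop3_dom loop3_dom_nmod_morphism.

Fact loop3_cod_nmod_morphism : nmod_morphism loop3_cod.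
Proof.
split; first by apply: loop2_ext; rewrite /= idE.
by move=> f g; apply: loop2_ext; rewrite /= tgt_loop3_add.
Qed.

HB.instance Definition _ :=
  GRing.isNmodMorphism.Build loop3 loop2 loop3_cod loop3_cod_nmod_morphism.

Lemma loop3_id_src a : src (src (idc (loop2_arr a))) = o1.
Proof. by rewrite idE loop2E. Qed.
Lemma loop3_id_tgt a : tgt (src (idc (loop2_arr a))) = o1.
Proof. by rewrite idE loop2E. Qed.
Definition loop3_id a := Loop3 (loop3_id_src a) (loop3_id_tgt a).

Fact loop3_id_nmod_morphism : nmod_morphism loop3_id.
Proof.
split; first by apply: loop3_ext.
move=> a b; apply: loop3_ext; rewrite /=.
by apply: (@idc_comp _ ax 0 1); rewrite /composable /= !loop2E.
Qed.

HB.instance Definition _ :=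
  GRing.isNmodMorphism.Build loop2 loop3 loop3_id loop3_id_nmod_morphism.

Lemma loop3_cmp_src f g : src (loop3_arr g) = tgt (loop3_arr f) ->
  src (src (comp 2 (loop3_arr g) (loop3_arr f))) = o1.
Proof. by move=> gf; rewrite (src_comp_top ax) ?loop3E. Qed.
Lemma loop3_cmp_tgt f g : src (loop3_arr g) = tgt (loop3_arr f) ->
  tgt (src (comp 2 (loop3_arr g) (loop3_arr f))) = o1.
Proof. by move=> gf; rewrite (src_comp_top ax) ?loop3E. Qed.

(** The boundary proofs exist only for composable pairs, hence the case distinction; [g] is a
    default value. *)
Definition loop3_cmp g f : loop3 :=
  match pselect (src (loop3_arr g) = tgt (loop3_arr f)) with
  | left gf => Loop3 (loop3_cmp_src gf) (loop3_cmp_tgt gf)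
  | right _ => g
  end.

Lemma loop3_dom_cod g f : loop3_dom g = loop3_cod f ->
  src (loop3_arr g) = tgt (loop3_arr f).
Proof. by move=> /(congr1 loop2_arr). Qed.

Lemma loop3_cmpE g f : loop3_dom g = loop3_cod f ->
  loop3_arr (loop3_cmp g f) = comp 2 (loop3_arr g) (loop3_arr f).
Proof.
move=> /loop3_dom_cod gf; rewrite /loop3_cmp.
by case: pselect.
Qed.

Lemma loop3_dom_id a : loop3_dom (loop3_id a) = a.
Proof. by apply: loop2_ext; rewrite /= idE. Qed.

Lemma loop3_cod_id a : loop3_cod (loop3_id a) = a.
Proof. by apply: loop2_ext; rewrite /= idE. Qed.

Lemma loop3_dom_cmp g f : loop3_dom g = loop3_cod f ->
  loop3_dom (loop3_cmp g f) = loop3_dom f.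
Proof.
move=> gf; apply: loop2_ext; rewrite /= loop3_cmpE // (src_comp_top ax) //.
exact: loop3_dom_cod gf.
Qed.

Lemma loop3_cod_cmp g f : loop3_dom g = loop3_cod f ->
  loop3_cod (loop3_cmp g f) = loop3_cod g.
Proof.
move=> gf; apply: loop2_ext; rewrite /= loop3_cmpE // (tgt_comp_top ax) //.
exact: loop3_dom_cod gf.
Qed.

Lemma loop3_cmpA h g f :
  loop3_dom h = loop3_cod g -> loop3_dom g = loop3_cod f ->
  loop3_cmp (loop3_cmp h g) f = loop3_cmp h (loop3_cmp g f).
Proof.
move=> hg gf; apply: loop3_ext.
rewrite !loop3_cmpE ?loop3_dom_cmp ?loop3_cod_cmp //.
apply: (@comp_assoc _ ax 0 2).
  exact: loop3_dom_cod hg.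
exact: loop3_dom_cod gf.
Qed.

Lemma loop3_cmp_idl f : loop3_cmp (loop3_id (loop3_cod f)) f = f.
Proof.
apply: loop3_ext; rewrite loop3_cmpE ?loop3_dom_id //.
exact: (@comp_idcl _ ax 0 2).
Qed.

Lemma loop3_cmp_idr f : loop3_cmp f (loop3_id (loop3_dom f)) = f.
Proof.
apply: loop3_ext; rewrite loop3_cmpE ?loop3_cod_id //.
exact: (@comp_idcr _ ax 0 2).
Qed.

(** The exchange law between [*2] and [*1]. *)
Lemma loop3_cmpD (g g' f f' : loop3) : loop3_dom g = loop3_cod f ->
  loop3_dom g' = loop3_cod f' ->
  loop3_cmp (g + g')%R (f + f')%R = (loop3_cmp g f + loop3_cmp g' f')%R.
Proof.
move=> gf gf'; apply: loop3_ext.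
rewrite loop3D !loop3_cmpE //; last by rewrite !raddfD /= gf gf'.
apply/esym/(@exchange _ ax 0 0 1) => /=.
- exact: loop3_dom_cod gf.
- by rewrite !loop3E.
- exact: loop3_dom_cod gf'.
Qed.

Hypothesis G3 : quasi_strict_3groupoid G.

(** Composites with a weak inverse are homotopic to units, hence equal to them in dimension 3. *)
Lemma loop3_inv f : exists g, [/\ loop3_dom g = loop3_cod f,
  loop3_cod g = loop3_dom f, loop3_cmp g f = loop3_id (loop3_dom f)
  & loop3_cmp f g = loop3_id (loop3_cod f)].
Proof.
have [v [w1 [w2 [[sv tv] h1 h2]]]] :=
  weakly_invertible_inv (G3.1 _ (loop3_arr f)).
have vs : src (src v) = o1 by rewrite sv !loop3E.
have vt : tgt (src v) = o1 by rewrite sv !loop3E.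
have e1 := @units_above_3_homotopic _ G3.2 3 _ _ isT (ex_intro _ w1 h1).
have e2 := @units_above_3_homotopic _ G3.2 3 _ _ isT (ex_intro _ w2 h2).
have gf : loop3_dom (Loop3 vs vt) = loop3_cod f by apply: loop2_ext.
have fg : loop3_dom f = loop3_cod (Loop3 vs vt) by apply: loop2_ext.
exists (Loop3 vs vt); split=> //; by apply: loop3_ext; rewrite loop3_cmpE.
Qed.

(** In dimension 2 inverses stay weak: the 3-arrow from the composite to the unit is the required
    [f]. *)
Lemma loop2_inv (a : loop2) :
  exists b f, loop3_dom f = (a + b)%R /\ loop3_cod f = 0%R.
Proof.
have [v [w1 [w2 [[sv tv] [h1 h1'] _]]]] :=
  weakly_invertible_inv (G3.1 _ (loop2_arr a)).
rewrite !loop2E in sv tv h1'.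
have ws : src (src w1) = o1.
  by rewrite h1 -(loop2_src (a + Loop2 sv tv)%R).
have wt : tgt (src w1) = o1.
  by rewrite h1 -(loop2_tgt (a + Loop2 sv tv)%R).
by exists (Loop2 sv tv), (Loop3 ws wt); split; apply: loop2_ext.
Qed.

Definition loop_picard : picard := {|
  pdom_id := loop3_dom_id; pcod_id := loop3_cod_id;
  pdom_cmp := loop3_dom_cmp; pcod_cmp := loop3_cod_cmp;
  pcmpA := loop3_cmpA; pcmp_idl := loop3_cmp_idl; pcmp_idr := loop3_cmp_idr;
  pcmpD := loop3_cmpD; pmor_inv := loop3_inv; pob_inv := loop2_inv |}.

End Loops.

(** * The pseudo-functor *)

Section Strictification.

Variables (G : inf_cat) (x0 : G 0) (G3 : quasi_strict_3groupoid G).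

Let P : picard := loop_picard x0 G3.

Local Notation H := (@complex_cat (fab (pob P)) (cone P) (@cone_ob P)).

Let A2 (a : pob P) : G 2 := loop2_arr a.
Let A3 (f : pmor P) : G 3 := loop3_arr f.

Local Notation "g ** f" := (@pcmp P g f) (at level 40, left associativity).

(** * Translation between [G] and [P] *)

Lemma A2D a b : comp 1 (A2 a) (A2 b) = A2 (a + b)%R.
Proof. by []. Qed.

Lemma A2D0 a b : comp 0 (A2 a) (A2 b) = A2 (a + b)%R.
Proof. exact: comp0_loop2. Qed.

Lemma A3D f g : comp 1 (A3 f) (A3 g) = A3 (f + g)%R.
Proof. by []. Qed.

Lemma A3D0 f g : comp 0 (A3 f) (A3 g) = A3 (f + g)%R.
Proof. exact: comp0_loop3. Qed.

Lemma A3_cmp f g : pdom P g = pcod P f -> comp 2 (A3 g) (A3 f) = A3 (g ** f).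
Proof. by move=> gf; rewrite /A3 loop3_cmpE. Qed.

Lemma A3_id a : idc (A2 a) = A3 (pid P a).
Proof. by []. Qed.

Lemma A2_0 : idc (idc x0) = A2 0%R.
Proof. by []. Qed.

Lemma A3_src f : src (A3 f) = A2 (pdom P f).
Proof. by []. Qed.

Lemma A3_tgt f : tgt (A3 f) = A2 (pcod P f).
Proof. by []. Qed.

Lemma A2_src a : src (A2 a) = idc x0.
Proof. exact: loop2_src. Qed.

Lemma A2_tgt a : tgt (A2 a) = idc x0.
Proof. exact: loop2_tgt. Qed.

(** Rewriting with [AE], then [A3_cmp], turns equations in [G] into equations in [P], where [*0] and
    [*1] are both the sum. *)
Definition AE := (A2D, A2D0, A3D, A3D0, A3_id, A2_0).

Lemma A3_iso f a b : pdom P f = a -> pcod P f = b -> iso3 (A2 a) (A2 b) (A3 f).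
Proof.
move=> <- <-; split; first by [].
exists (A3 (pinv f)); rewrite /= !A3_cmp ?pdcE // A3_src A3_tgt.
by rewrite !AE pcmpfV pcmpVf ?A3_src ?A3_tgt !pdcE.
Qed.

(** [A2 0] and [A3 0] are iterated units of [x0]. The content lies in [tri_phi] and [tri_chi2],
    which both compare sums but in opposite directions, hence [mu] for one and its inverse [nu] for
    the other. *)
Definition strict_trihom : trihom_data H G := {|
  tri0 := fun _ : H 0 => x0;
  tri1 := fun _ : H 1 => idc x0;
  tri2 := fun a : H 2 => A2 (@real P a);
  tri3 := fun u : H 3 => A3 (@push P u.1 u.2);
  tri_phi := fun b a : H 2 => A3 (@mu P b a);
  tri_phi0 := fun=> A3 0%R;
  tri_chi := fun _ _ => A2 0%R;
  tri_chi2 := fun b a : H 2 => A3 (@nu P b a);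
  tri_iota := fun=> A2 0%R;
  tri_iota2 := fun=> A3 0%R;
  tri_omega := fun _ _ _ => A3 0%R;
  tri_gamma := fun=> A3 0%R;
  tri_delta := fun=> A3 0%R
|}.

Ltac trihomE :=
  cbn [tri0 tri1 tri2 tri3 tri_phi tri_phi0 tri_chi tri_chi2 tri_iota tri_iota2
       tri_omega tri_gamma tri_delta strict_trihom].

Lemma comp1_H2 (a b : H 2) : comp 1 a b = (a + b)%R :> fab (pob P).
Proof. by []. Qed.

Lemma comp0_H2 (a b : H 2) : comp 0 a b = (a + b)%R :> fab (pob P).
Proof. by []. Qed.

Lemma idc_H1 (f : H 1) : idc f = 0%R :> fab (pob P).
Proof. by []. Qed.

Lemma comp1_H3 (u v : H 3) : comp 1 u v = (u.1 + v.1, u.2 + v.2)%R.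
Proof. by []. Qed.

Lemma comp0_H3 (u v : H 3) : comp 0 u v = (u.1 + v.1, u.2 + v.2)%R.
Proof. by []. Qed.

Lemma comp2_H3 (u v : H 3) : comp 2 u v = (v.1, u.2 + v.2)%R.
Proof. by []. Qed.

Lemma idc_H2 (a : H 2) : idc a = (a, 0%R).
Proof. by []. Qed.

Definition HE :=
  (comp1_H2, comp0_H2, idc_H1, comp1_H3, comp0_H3, comp2_H3, idc_H2).

Lemma hom_H3 (a b : H 2) (u : H 3) : hom a b u ->
  a = u.1 /\ b = (u.1 + cone_ob u.2)%R.
Proof. by case=> <- <-. Qed.

Lemma strict_globular : globular_axioms strict_trihom.
Proof.
split.
- move=> x y f _.
  by split; rewrite /= ?(src_idc (inf_catP G)) ?(tgt_idc (inf_catP G)).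
- by move=> f g a _; split; [apply: A2_src|apply: A2_tgt].
- move=> a b u /hom_H3[-> ->]; split.
    by rewrite A3_src pdom_push.
  by rewrite A3_tgt pcod_push.
Qed.

Definition pushE := (pdom_push, pcod_push, muE).

(** Translated to [P], the conditions are [push_cmp], [push0], [push_mu], [mu_assoc] and the unit
    laws of [mu]. *)
Lemma strict_local : local_axioms strict_trihom.
Proof.
split; trihomE.
- move=> u' u e; have {}e : u'.1 = (u.1 + cone_ob u.2)%R by [].
  by rewrite !HE A3_cmp ?pushE e // push_cmp.
- by move=> a; rewrite HE push0 AE.
- move=> b a _; rewrite !HE !AE; apply: A3_iso; by rewrite !muE.
- by move=> f; rewrite HE !AE real0; apply: A3_iso; rewrite ?raddf0.
- move=> b b' a a' T S /hom_H3[-> ->] /hom_H3[-> ->] _.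
  by rewrite !HE !AE !A3_cmp ?pushE // push_mu.
- by move=> c b a _ _; rewrite !HE !AE !A3_cmp ?muE // mu_assoc.
- move=> f g a _; rewrite !HE !AE A3_cmp ?muE // mu0r.
  by rewrite pcmp_idlE addr0 ?muE.
- move=> f g a _; rewrite !HE !AE A3_cmp ?muE // mu0l.
  by rewrite pcmp_idlE add0r ?muE.
Qed.

Lemma A2_weakly_invertible a : weakly_invertible (A2 a).
Proof. exact: G3.1. Qed.

Lemma A2_hom a : hom (idc x0) (idc x0) (A2 a).
Proof. by split; [apply: A2_src|apply: A2_tgt]. Qed.

Lemma idc1_comp : comp 0 (idc x0) (idc x0) = idc x0.
Proof.
have := @comp_idcr _ (inf_catP G) 0 0 (idc x0).
by rewrite /= (src_idc (inf_catP G)).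
Qed.

Lemma strict_chi : chi_axioms strict_trihom.
Proof.
split; trihomE.
- by move=> g f _; rewrite idc1_comp; apply: A2_hom.
- by move=> g f _; apply: A2_weakly_invertible.
- move=> g g' f f' b a _ _ _; rewrite !HE !AE addr0 add0r.
  by apply: A3_iso; rewrite muE.
- move=> g g' f f' b b' a a' T S /hom_H3[-> ->] /hom_H3[-> ->] _ _ _.
  rewrite !HE !AE raddf0 addr0 add0r; cbn [fst snd].
  have e : (T.1 + cone_ob T.2 + (S.1 + cone_ob S.2) =
            T.1 + S.1 + cone_ob (T.2 + S.2))%R by rewrite raddfD addrACA.
  rewrite !A3_cmp ?pushE ?e //; apply: (congr1 A3).
  (* Naturality of [nu] is the square [push_mu] with its [mu] sides inverted. *)
  by apply: pinv_square; rewrite ?pushE ?e // push_mu.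
- move=> g f _; rewrite !HE !AE !raddf0 !addr0 /nu mu0l pinv_id real0 raddf0.
  by rewrite A3_cmp ?pdcE // -[0%R](raddf0 (pid P)) pcmp_idlE // pcod_id.
- move=> g g' g'' f f' f'' b b' a a' _ _ _ _ _.
  rewrite !HE !AE !raddf0 !addr0 !add0r.
  have e : (b' + b + (a' + a) = b' + a' + (b + a))%R by rewrite addrACA.
  rewrite !A3_cmp ?pdom_cmp ?pcod_cmp ?muE ?e //; last exact: addrACA.
  apply: (congr1 A3).
  (* Once identities are removed, [mu] stands for [*1] and [nu] for [*0]: the equation is [mu_ACA]
     with two opposite sides inverted. *)
  rewrite pcmpD ?muE // !pcmp_idlE ?pcmp_idrE ?muE //.
  rewrite -!pinvD; apply: pinv_square; rewrite ?muE ?e //.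
    exact: addrACA.
  exact: (mu_ACA b' a' b a).
Qed.

Lemma strict_iota : iota_axioms strict_trihom.
Proof.
split; trihomE.
- move=> x; apply: A2_hom.
- move=> x; apply: A2_weakly_invertible.
- move=> x; rewrite !HE !AE real0 !addr0; apply: A3_iso; exact: raddf0.
- move=> x; rewrite !AE !raddf0 !addr0 A3_cmp ?pdcE //.
  by rewrite -[0%R](raddf0 (pid P)) pcmp_idlE // pcod_id.
- by move=> x; rewrite !HE !AE mu0l real0 !raddf0 !addr0.
Qed.

Lemma pcmp0 : (0 : pmor P)%R ** 0%R = 0%R.
Proof. by rewrite -[0%R](raddf0 (pid P)) pcmp_idlE // pcod_id. Qed.

Lemma strict_modification : modification_axioms strict_trihom.
Proof.
split; trihomE.
- move=> h g f _ _; rewrite !AE !addr0; apply: A3_iso; exact: raddf0.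
(* As [tri_omega] is a unit, its naturality is the coassociativity [nu_assoc]. *)
- move=> h h' g g' f f' c b a _ _ _ _ _; rewrite !HE !AE !addr0 !add0r !raddf0.
  rewrite !addr0 !add0r !A3_cmp ?pdom_cmp ?pcod_cmp ?muE ?addrA //.
  apply: (congr1 A3).
  rewrite pcmp_idlE ?[_ ** pid P _]pcmp_idrE ?pcod_cmp ?muE ?addrA //.
  exact: nu_assoc.
- move=> x y f _; rewrite !AE !addr0; apply: A3_iso; exact: raddf0.
- move=> x y f f' a _ _; rewrite !HE !AE !raddf0 !addr0 !add0r /nu mu0l pinv_id.
  rewrite raddf0 addr0 !A3_cmp ?pdom_cmp ?pcod_cmp ?muE //.
  by rewrite !pcmp_idlE ?pcod_cmp ?muE.
- move=> x y f _; rewrite !AE !addr0; apply: A3_iso; exact: raddf0.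
- move=> x y f f' a _ _; rewrite !HE !AE !raddf0 !addr0 !add0r /nu mu0r pinv_id.
  rewrite raddf0 addr0 !A3_cmp ?pdom_cmp ?pcod_cmp ?muE //.
  by rewrite !pcmp_idlE ?pcod_cmp ?muE.
Qed.

Lemma A3_id0 : idc (A2 0%R) = A3 0%R.
Proof. by []. Qed.

Lemma A3_cmp0 : comp 2 (A3 0%R) (A3 0%R) = A3 0%R.
Proof. by rewrite A3_cmp ?pcmp0 // !raddf0. Qed.

Definition ZE := (A2D, A2D0, A3D, A3D0, A2_0, A3_id0, A3_cmp0,
  addr0 (0 : pob P)%R, addr0 (0 : pmor P)%R).

(** Every arrow in these equations is an iterated unit of [x0]. *)
Lemma strict_coherence : coherence_axioms strict_trihom.
Proof.
by split; trihomE; intros; rewrite !ZE.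
Qed.

Definition strict_pseudo_functor : pseudo_functor H G := {|
  pf_globular := strict_globular;
  pf_local := strict_local;
  pf_chi := strict_chi;
  pf_iota := strict_iota;
  pf_modification := strict_modification;
  pf_coherence := strict_coherence |}.

Local Notation F := strict_pseudo_functor.

(** * Effect on homotopy groups *)

Lemma homotopic_A2 a b :
  homotopic (A2 a) (A2 b) <-> exists f, pdom P f = a /\ pcod P f = b.
Proof.
split=> [[u [us ut]]|[f [<- <-]]]; last by exists (A3 f).
have s1 : src (src u) = idc x0 by rewrite us A2_src.
have t1 : tgt (src u) = idc x0 by rewrite us A2_tgt.
by exists (Loop3 s1 t1); split; apply: loop2_ext.
Qed.

Lemma loop_A2 (v : G 2) : loop x0 v -> exists a, v = A2 a.
Proof. by case=> vs vt; exists (Loop2 vs vt). Qed.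

Lemma A2_loop a : loop x0 (A2 a).
Proof. exact: A2_hom. Qed.

Lemma loop_A3 (v : G 3) : loop x0 v ->
  exists f, [/\ v = A3 f, pdom P f = 0%R & pcod P f = 0%R].
Proof.
case=> vs vt.
have s1 : src (src v) = idc x0 by rewrite vs /= (src_idc (inf_catP G)).
have t1 : tgt (src v) = idc x0 by rewrite vs /= (tgt_idc (inf_catP G)).
by exists (Loop3 s1 t1); split=> //; apply: loop2_ext.
Qed.

Lemma A3_loop f : pdom P f = 0%R -> pcod P f = 0%R -> loop x0 (A3 f).
Proof. by move=> df cf; split; rewrite ?A3_src ?A3_tgt ?df ?cf. Qed.

Lemma loop_H3 (x : H 0) (u : H 3) : loop x u ->
  u.1 = 0%R /\ cone_ob u.2 = 0%R.
Proof.
by case=> us ut; have [us' ut'] := hom_H3 (conj us ut);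
   split; rewrite ?[u.1]us' //; move: ut'; rewrite -us' /= add0r => <-.
Qed.

Lemma H2_loop (x : H 0) (u : H 2) : loop x u.
Proof. by split. Qed.

Lemma pi_map2 (x : H 0) (u : H 2) a :
  pi_map F x (n := 1) u (A2 a) <-> homotopic (A2 a) (A2 (real u)).
Proof. by rewrite /pi_map /= !AE add0r addr0. Qed.

(** A loop is a pair [(0, c)] with [c] of boundary [0]; [push] reduces there to [cone_mor c], and
    homotopic 3-arrows of [G] are equal. *)
Lemma pi_map3 (x : H 0) (u : H 3) f : loop x u -> pdom P f = 0%R ->
  pcod P f = 0%R -> pi_map F x (n := 2) u (A3 f) <-> cone_mor u.2 = f.
Proof.
move=> lu df cf; have [u1 u2] := loop_H3 lu.
rewrite /pi_map; cbn [pf_data strict_pseudo_functor]; trihomE.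
rewrite !AE !raddf0 !addr0 !add0r u1 push_zero.
have dc := pdom_cone u.2; have cc := pcod_cone u.2; rewrite u2 real0 in cc.
rewrite !A3_cmp ?dc ?cf ?raddf0 //.
rewrite -[0%R](raddf0 (pid P)) pcmp_idlE ?pcmp_idrE //.
split=> [/(@units_above_3_homotopic _ G3.2 3 _ _ isT) /loop3_ext //|->].
exact: homotopic_refl.
Qed.

Hypothesis Gx0 : forall y : G 0, homotopic y x0.
Hypothesis G1 : forall u : G 1, loop x0 u -> homotopic u (idc x0).

Lemma strict_pi0 : pi0_bijective F.
Proof.
split=> [x y|y]; last by exists tt; apply/(homotopic_sym G3.1)/Gx0.
split=> _; first exact: homotopic_refl.
by exists tt; case: x y => [] [].
Qed.

(** Both groups are trivial, that of [G] by [G1]. *)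
Lemma strict_pi1 (x : H 0) : pi_isomorphic F x 0.
Proof.
have G1' v : loop x0 v -> homotopic (idc x0) v.
  by move=> /G1/(homotopic_sym G3.1).
split.
- move=> u _; exists (idc x0).
  by split; [apply: (idobj_loop x0 0)|apply: homotopic_refl].
- by move=> v lv; exists tt; split; [split; case: (x)|apply: G1'].
- move=> [] [] v v' _ _ lv lv' _ _; split=> _; last exact: homotopic_refl.
  exact: homotopic_trans (G1 lv) (G1' _ lv').
- move=> u u' v v' _ _ [vs vt] [vs' vt'] _ _; apply: G1'.
  split; rewrite ?(src_comp_top (inf_catP G)) ?(tgt_comp_top (inf_catP G));
  by rewrite ?vs ?vt'.
Qed.

Lemma strict_pi2 (x : H 0) : pi_isomorphic F x 1.
Proof.
split.
- move=> u _; exists (A2 (real u)); split; first exact: A2_loop.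
  by apply/pi_map2/homotopic_refl.
- move=> v /loop_A2[a ->]; exists (fab_gen a); split; first exact: H2_loop.
  by apply/pi_map2; rewrite real_gen; apply: homotopic_refl.
- move=> u u' v v' _ _ /loop_A2[a ->] /loop_A2[a' ->] /pi_map2 h /pi_map2 h'.
  (* A 3-arrow of [H] is sent by [push] to an arrow between realizations; conversely [cone_lift]
     provides a 3-arrow of [H]. *)
  split=> [[w /hom_H3[eu eu']]|ha].
    apply: (homotopic_trans h); apply: homotopic_trans (homotopic_sym G3.1 h').
    apply/homotopic_A2; exists (push w.1 w.2).
    by rewrite pdom_push pcod_push eu' eu.
  have /homotopic_A2[f [df cf]] : homotopic (A2 (real u)) (A2 (real u')).
    exact: homotopic_trans (homotopic_sym G3.1 h) (homotopic_trans ha h').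
  have [c ec] := cone_lift df cf.
  by exists (u, c); split.
- move=> u u' v v' _ _ /loop_A2[a ->] /loop_A2[a' ->].
  move=> /pi_map2/homotopic_A2[f [df cf]] /pi_map2/homotopic_A2[f' [df' cf']].
  rewrite A2D; apply/pi_map2/homotopic_A2.
  (* [mu] leads from the sum of the realizations to the realization of the sum. *)
  exists (mu u u' ** (f + f')%R).
  by rewrite pdom_cmp ?pcod_cmp ?muE ?df ?df' ?cf ?cf'.
Qed.

(** A cone with boundary [0] is an automorphism of [0] in [P], so both groups consist of the same
    arrows. *)
Lemma strict_pi3 (x : H 0) : pi_isomorphic F x 2.
Proof.
split.
- move=> u lu; have [u0 u0'] := loop_H3 lu.
  have df := pdom_cone u.2; have cf := pcod_cone u.2.
  rewrite u0' real0 in cf.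
  by exists (A3 (cone_mor u.2)); split; [apply: A3_loop|apply/pi_map3].
- move=> v /loop_A3[f [-> df cf]].
  have cf' : pcod P f = real 0%R by rewrite real0.
  exists (0%R, mk_cone df cf').
  have lu : @loop H 2 x (0%R, mk_cone df cf') by split; last exact: addr0.
  by split=> //; apply/(pi_map3 lu df cf).
- move=> u u' v v' lu lu' /loop_A3[f [-> df cf]] /loop_A3[f' [-> df' cf']].
  move=> /(pi_map3 lu df cf) e /(pi_map3 lu' df' cf') e'.
  have [u1 u2] := loop_H3 lu; have [u1' u2'] := loop_H3 lu'.
  split=> [/(@units_above_3_homotopic H (@complex_units _ _ _) 3 u u' isT) eu|].
    by rewrite -e -e' eu; apply: homotopic_refl.
  move=> /(@units_above_3_homotopic _ G3.2 3 _ _ isT) /loop3_ext ef.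
  have -> : u = u'; last exact: homotopic_refl.
  case: u u' e e' u1 u2 u1' u2' {lu lu'} => [a c] [a' c'] /= e e' -> c0 -> c0'.
  by congr (_, _); apply: cone_ext; rewrite ?c0 ?c0' // e e' ef.
- move=> u u' v v' lu lu' /loop_A3[f [-> df cf]] /loop_A3[f' [-> df' cf']].
  move=> /(pi_map3 lu df cf) e /(pi_map3 lu' df' cf') e'.
  have [u1 u2] := loop_H3 lu; have [u1' u2'] := loop_H3 lu'.
  have cu : pdom P f = pcod P f' by rewrite df cf'.
  rewrite A3_cmp //; apply/pi_map3; rewrite ?pdom_cmp ?pcod_cmp //.
    have ut : (u'.1 + cone_ob (u.2 + u'.2) = 0)%R.
      by rewrite raddfD /= u1' u2 u2' !addr0.
    by split; rewrite HE; [exact: u1'|exact: ut].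
  (* Seen as arrows [push 0], cones of boundary [0] add up by composition. *)
  rewrite HE -push_zero -push_cmp u2' addr0 !push_zero e e' //.
Qed.

(** In these dimensions the only loops on either side are units. *)
Lemma strict_pi_gt3 (x : H 0) n : pi_isomorphic F x n.+3.
Proof.
have H3 : units_above_3 H := @complex_units _ _ _.
split.
- move=> u lu; exists (idobj n.+4 x0); split; first exact: idobj_loop.
  split; last exact: homotopic_refl.
  by rewrite (loop_units H3 _ lu) //; apply: homotopic_refl.
- move=> v lv; exists (idobj n.+4 x); split; first exact: idobj_loop.
  split; first exact: homotopic_refl.
  by rewrite (loop_units G3.2 _ lv) //; apply: homotopic_refl.
- move=> u u' v v' lu lu' lv lv' _ _.
  rewrite (loop_units H3 _ lu) // (loop_units H3 _ lu') //.
  rewrite (loop_units G3.2 _ lv) // (loop_units G3.2 _ lv') //.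
  by split=> _; apply: homotopic_refl.
- move=> u u' v v' lu lu' lv lv' _ _.
  rewrite (loop_units H3 _ lu) // (loop_units H3 _ lu') //.
  rewrite (loop_units G3.2 _ lv) // (loop_units G3.2 _ lv') //.
  by rewrite !idobj_comp; split; apply: homotopic_refl.
Qed.

Lemma strict_weak_equivalence : weak_equivalence F.
Proof.
split=> [|x [|[|[|n]]]]; first exact: strict_pi0.
- exact: strict_pi1.
- exact: strict_pi2.
- exact: strict_pi3.
- exact: strict_pi_gt3.
Qed.

End Strictification.

Theorem mainTheorem6 :
  forall G : inf_cat,
    quasi_strict_3groupoid G -> simply_connected G ->
    exists (H : inf_cat) (F : pseudo_functor H G),
      strict_3groupoid H /\ weak_equivalence F.
Proof.
move=> G G3 [[x0 Gx0] G1].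
exists (complex_cat (@cone_ob (loop_picard x0 G3))).
exists (strict_pseudo_functor x0 G3).
split; first by split; [apply: complex_strict_groupoid|apply: complex_units].
by apply: strict_weak_equivalence => // u; apply: G1.
Qed.
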